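(* Consider the three-dimensional incompressible Navier-Stokes equations. Let $E$ be a bounded Borel set in $H$ such that $\mathcal{P}_{\mathrm{wsss}}(E)$ is not empty. Let $\phi\in\mathcal{C}(E)$. Then $$\sup_{\mu\in\mathcal{P}_{\mathrm{fpsss}}(E)}\int_E\phi(u)\,d\mu(u)\ \le\ \sup_{\mu\in\mathcal{P}_{\mathrm{wsss}}(E)}\int_E\phi(u)\,d\mu(u)\ \le\ \inf_{\Psi\in\mathcal{T}^{\mathrm{cyl}}(W')}\ \sup_{u\in E}\left\{\phi(u)+\langle F(u),\Psi'(u)\rangle_{W',W}\right\}.$$
   Context: Let $\Omega\subset\mathbb{R}^3$ be a bounded domain with smooth boundary and $\nu>0$. The Navier-Stokes equations are $\partial_t u-\nu\Delta u+(u\cdot\nabla)u+\nabla p=f$, $\nabla\cdot u=0$ in $\Omega$, with $u=0$ on $\partial\Omega$ and time-independent $f$. $H$ is the space of square-integrable divergence-free vector fields on $\Omega$ with vanishing normal component on $\partial\Omega$, with the $L^2(\Omega)^3$ inner product and norm $\|\cdot\|$; $V=H\cap H^1_0(\Omega)^3$, with the $H_0^1$ inner product $\langle\nabla u,\nabla v\rangle_{L^2}$; $H$ is identified with its dual, so $V\subset H\subset V'$; $f\in V'$. The Stokes operator $A:V\to V'$ is given by $\langle Au,v\rangle_{V',V}=\langle\nabla u,\nabla v\rangle_{L^2}$, and $D(A)=\{u\in V:\ Au\in H\}$. $B(\cdot,\cdot):V\times V\to V'$ is given by $\langle B(u,v),w\rangle_{V',V}=\int_\Omega((u\cdot\nabla)v)\cdot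 w\,dx$, and $F(u)=f-\nu Au-B(u,u)$ maps $V$ continuously into $V'$. $W=D(A)\cap W^{1,\infty}(\Omega)^3$, with its natural Banach norm, and $H\subset W'$ through the $L^2$ inner product. $F$ extends to a continuous map $F:H\to W'$, given by $\langle F(u),w\rangle_{W',W}=\langle f,w\rangle_{V',V}-\nu\langle u,Aw\rangle_{L^2}+\int_\Omega((u\cdot\nabla)w)\cdot u\,dx$. For a Banach space $Y$, $\mathcal{T}^{\mathrm{cyl}}(Y')$ is the set of functions $\Psi:Y'\to\mathbb{R}$ of the form $\Psi(u)=\psi(\langle u,w_1\rangle_{Y',Y},\ldots,\langle u,w_m\rangle_{Y',Y})$, with $m\in\mathbb{N}$, $w_j\in Y$, $\psi\in\mathcal{C}^1_c(\mathbb{R}^m)$ (compactly supported, continuously differentiable, real-valued); its derivative is $\Psi'(u)=\sum_{j=1}^m\partial_j\psi(\langle u,w_1\rangle_{Y',Y},\ldots,\langle u,w_m\rangle_{Y',Y})\,w_j\in Y$. Weak stationary statistical solution: a Borel probability measure $\mu$ on $H$ such that, for every $\Psi\in\mathcal{T}^{\mathrm{cyl}}(W')$, the map $u\mapsto\langle F(u),\Psi'(u)\rangle_{W',W}$ is $\mu$-integrable and $\int_H\langle F(v),\Psi'(v)\rangle_{W',W}\,d\mu(v)=0$. Foias-Prodi stationary statistical solution: a Borel probability measure $\mu$ on $H$ such that (i) $\int_H\|\nabla u\|^2\,d\mu(u)<\infty$ (with $\|\nabla u\|=\infty$ if $u\notin V$, so $\mu$ is carried by $V$); (ii) $\int_H\psi'(\|u\|^2)\left(\nu\|\nabla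 u\|^2-\langle f,u\rangle_{V',V}\right)d\mu(u)\le0$ for every real-valued continuously differentiable function $\psi$ on $[0,\infty)$ which is nonnegative, nondecreasing and has bounded derivative; (iii) $\int_H\langle F(u),\Psi'(u)\rangle_{V',V}\,d\mu(u)=0$ for all $\Psi\in\mathcal{T}^{\mathrm{cyl}}(V')$. For a Borel set $E\subset H$, $\mathcal{P}_{\mathrm{wsss}}(E)$ and $\mathcal{P}_{\mathrm{fpsss}}(E)$ are the sets of weak, respectively Foias-Prodi, stationary statistical solutions carried by $E$, i.e. with $\mu(H\setminus E)=0$. $\mathcal{C}(E)$ is the space of continuous real-valued functions on $E$ (norm topology of $H$). Suprema are in the extended reals, with $\sup\emptyset=-\infty$. *)

(* Defs.v *)
From HB Require Import structures.
From mathcomp Require Import all_boot all_order all_algebra.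
From mathcomp Require Import all_classical all_reals all_analysis.
Import Order.TTheory GRing.Theory Num.Theory numFieldNormedType.Exports.

Set Implicit Arguments.
Unset Strict Implicit.
Unset Printing Implicit Defensive.

Local Open Scope classical_set_scope.
Local Open Scope ring_scope.

(* Functions and vector fields on Omega are represented by total functions on
   R^3 of which only the restriction to Omega matters: integrals, L^2 classes
   and weak derivatives are all taken on Omega. *)

Section Space.
Context {R : realType}.

(* The norm topology of R * R * R and the product of the Borel
   sigma-algebras. *)
Definition R3 : Type := (R * R * R)%type.
HB.instance Definition _ := NormedModule.copy R3 (R * R * R)%type.
HB.instance Definition _ := Measurable.copy R3
  (measurableTypeR R * measurableTypeR R * measurableTypeR R)%type.

Definition leb3 : {measure set R3 -> \bar R} :=
  ((@lebesgue_measure R \x @lebesgue_measure R) \x @lebesgue_measure R)%E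
  : {measure set (measurableTypeR R * measurableTypeR R * measurableTypeR R)
     -> \bar R}.

(* u i is the i-th component of the vector field u. *)
Definition vfield : Type := 'I_3 -> R3 -> R.

HB.instance Definition _ := GRing.Lmodule.copy vfield ('I_3 -> R3 -> R).
HB.instance Definition _ := Choice.copy vfield ('I_3 -> R3 -> R).

Definition dirv (j : 'I_3) : R3 :=
  ((j == 0%N :> nat)%:R, (j == 1%N :> nat)%:R, (j == 2%N :> nat)%:R).

Definition partial (j : 'I_3) (f : R3 -> R) : R3 -> R :=
  fun x => 'D_(dirv j) f x.

Fixpoint Ck (n : nat) (f : R3 -> R) : Prop :=
  if n is n'.+1 then
    (forall x j, derivable f x (dirv j)) /\
    (forall j, Ck n' (partial j f))
  else continuous f.

Definition smooth (f : R3 -> R) : Prop := forall n, Ck n f.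

(* The boundary is smooth if, near each of its points, Omega is the sublevel
   set {rho < 0} of a smooth function with nonzero gradient at that point. *)
Definition smooth_boundary (Omega : set R3) : Prop :=
  forall x, (closure Omega `\` interior Omega) x ->
    exists2 rho : R3 -> R, smooth rho /\ (exists j, partial j rho x != 0) &
      \forall y \near x, Omega y <-> rho y < 0.

Definition smooth_bounded_domain (Omega : set R3) : Prop :=
  [/\ open Omega, connected Omega, Omega !=set0, bounded_set Omega &
      smooth_boundary Omega].

End Space.
Arguments R3 : clear implicits.
Arguments vfield : clear implicits.

Section Spaces.
Context {R : realType} (Omega : set (R3 R)).
Implicit Types (u v w g : vfield R) (q phi : R3 R -> R).

Definition test_function phi : Prop :=
  [/\ smooth phi, compact (closure [set x | phi x != 0]) &
      closure [set x | phi x != 0] `<=` Omega].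

Definition intO (q : R3 R -> R) : R := \int[leb3]_(x in Omega) q x.

Definition L2 q : Prop :=
  measurable_fun Omega q /\
  leb3.-integrable Omega (fun x => (q x ^+ 2)%:E).

Definition Linfty q : Prop :=
  measurable_fun Omega q /\
  exists M : R, {ae leb3, forall x, Omega x -> `|q x| <= M}.

(* d is the j-th partial derivative of q in the sense of distributions. *)
Definition weak_partial (j : 'I_3) q (d : R3 R -> R) : Prop :=
  forall phi, test_function phi ->
    intO (fun x => q x * partial j phi x) = - intO (fun x => d x * phi x).

Definition H1 q : Prop :=
  L2 q /\ forall j, exists2 d, L2 d & weak_partial j q d.

(* The j-th weak derivative in L^2, unique almost everywhere when it exists. *)
Definition wpartial (j : 'I_3) q : R3 R -> R :=
  xget (fun=> 0) [set d | L2 d /\ weak_partial j q d].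

Definition L2sq q : R := intO (fun x => q x ^+ 2).

Definition H10 q : Prop :=
  H1 q /\ forall e : R, 0 < e -> exists2 phi, test_function phi &
    L2sq (fun x => q x - phi x) < e /\
    forall j, L2sq (fun x => wpartial j q x - partial j phi x) < e.

Definition W1infty q : Prop :=
  Linfty q /\ forall j, exists2 d, Linfty d & weak_partial j q d.

Definition divergence_free u : Prop :=
  forall phi, test_function phi ->
    intO (fun x => \sum_j u j x * partial j phi x) = 0.

(* For u in L^2 with div u = 0, Green's formula defines the normal trace of u
   on the boundary, as a functional on traces of functions q in H^1, by
   <u.n, q> = int (u . grad q) + int (div u) q = int (u . grad q). *)
Definition zero_normal_trace u : Prop :=
  forall q, H1 q -> intO (fun x => \sum_j u j x * wpartial j q x) = 0.

Definition Hfield : set (vfield R) :=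
  [set u | [/\ forall i, L2 (u i), divergence_free u & zero_normal_trace u]].

Definition Vfield : set (vfield R) :=
  [set u | Hfield u /\ forall i, H10 (u i)].

Definition ip u v : R := intO (fun x => \sum_i u i x * v i x).

Definition nrm u : R := Num.sqrt (ip u u).

Definition ip_grad u v : R :=
  intO (fun x => \sum_i \sum_j wpartial j (u i) x * wpartial j (v i) x).

Definition stokes u : vfield R -> R := fun v => ip_grad u v.

(* A u belongs to H and is represented there by g. *)
Definition stokes_in_H u g : Prop :=
  Hfield g /\ forall v, Vfield v -> ip g v = stokes u v.

Definition DA : set (vfield R) :=
  [set u | Vfield u /\ exists g, stokes_in_H u g].

(* W = D(A) /\ W^{1,infty}(Omega)^3. An element w of W is recorded together
   with A w, as the pair (w, A w): A w is determined by w, since V is dense in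
   H, so that this is W itself, with the linear structure of the graph of A. *)
Definition Wspace : set (vfield R * vfield R) :=
  [set p | [/\ DA p.1, forall i, W1infty (p.1 i) & stokes_in_H p.1 p.2]].

Definition V_dual (f : vfield R -> R) : Prop :=
  (forall (a : R) u v, Vfield u -> Vfield v -> f (a *: u + v) = a * f u + f v)
  /\ exists C : R, forall v, Vfield v -> `|f v| <= C * Num.sqrt (ip_grad v v).

Definition Bform u v w : R :=
  intO (fun x => \sum_i (\sum_j u j x * wpartial j (v i) x) * w i x).

Definition F_V (nu : R) (f : vfield R -> R) u : vfield R -> R :=
  fun w => f w - nu * stokes u w - Bform u u w.

Definition F_W (nu : R) (f : vfield R -> R) u : vfield R * vfield R -> R :=
  fun p => f p.1 - nu * ip u p.2 + Bform u p.1 u.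

(* The embeddings of H in V' and in W', through the L^2 inner product. *)
Definition H_to_Vdual u : vfield R -> R := fun w => ip u w.
Definition H_to_Wdual u : vfield R * vfield R -> R := fun p => ip u p.1.

End Spaces.

Section PhaseSpace.
Context {R : realType} (Omega : set (R3 R)).

(* The space H: fields in Hfield modulo equality almost everywhere in Omega. *)
Definition Hfield_eqv (a b : set_type (Hfield Omega)) : bool :=
  `[< {ae leb3, forall x, Omega x -> forall i, val a i x = val b i x} >].

Lemma Hfield_eqv_refl : reflexive Hfield_eqv.
Proof. by move=> a; apply/asboolP; apply: aeW. Qed.

Lemma Hfield_eqv_sym : symmetric Hfield_eqv.
Proof.
have sym (a b : set_type (Hfield Omega)) : Hfield_eqv a b -> Hfield_eqv b a.
  move=> /asboolP ab; apply/asboolP; apply: filterS ab => x ab Ox i.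
  by rewrite ab.
by move=> a b; apply/idP/idP; exact: sym.
Qed.

Lemma Hfield_eqv_trans : transitive Hfield_eqv.
Proof.
move=> b a c /asboolP ab /asboolP bc; apply/asboolP.
by apply: filterS2 ab bc => x ab bc Ox i; rewrite ab// bc.
Qed.

Canonical Hfield_equiv :=
  EquivRel Hfield_eqv Hfield_eqv_refl Hfield_eqv_sym Hfield_eqv_trans.

Definition Hspace : Type := {eq_quot Hfield_eqv}%qT.
HB.instance Definition _ := Choice.on Hspace.
HB.instance Definition _ := EqQuotient.on Hspace.

Definition Hrepr (u : Hspace) : vfield R := val (repr u).

Lemma Hfield0 : (0 : vfield R) \in Hfield Omega.
Proof.
have int0 (h : R3 R -> R) : (forall x, h x = 0) -> intO Omega h = 0.
  move=> h0; rewrite /intO /Rintegral.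
  by rewrite (eq_integral (fun=> 0%E)) ?integral0// => x _; rewrite h0.
apply/mem_set; split.
- move=> i; split; first exact: measurable_cst.
  rewrite (_ : (fun _ => _) = cst 0%E); first exact: integrable0.
  by apply/funext => x; rewrite /= expr0n.
- by move=> phi _; apply: int0 => x; rewrite big1// => j _; rewrite mul0r.
- by move=> q _; apply: int0 => x; rewrite big1// => j _; rewrite mul0r.
Qed.

HB.instance Definition _ :=
  isPointed.Build Hspace (\pi_Hspace (exist _ 0 Hfield0))%qT.

Definition Hnorm (u : Hspace) : R := nrm Omega (Hrepr u).

Definition Hdist (u v : Hspace) : R := nrm Omega (Hrepr u - Hrepr v).

Definition Hopen (U : set Hspace) : Prop :=
  forall u, U u -> exists2 e : R, 0 < e & forall v, Hdist u v < e -> U v.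

Lemma HopenT : Hopen setT.
Proof. by move=> u _; exists 1. Qed.

Lemma HopenI : setI_closed Hopen.
Proof.
move=> A B oA oB u [/oA[a a0 Aa] /oB[b b0 Bb]].
exists (Num.min a b) => [|v]; first by rewrite lt_min a0 b0.
by rewrite lt_min => /andP[va vb]; split; [exact: Aa|exact: Bb].
Qed.

Lemma Hopen_bigU (I : Type) (A : I -> set Hspace) :
  (forall i, Hopen (A i)) -> Hopen (\bigcup_i A i).
Proof.
move=> oA u [i _ /oA[e e0 Ae]]; exists e => // v /Ae Av.
by exists i.
Qed.

HB.instance Definition _ :=
  isOpenTopological.Build Hspace HopenT HopenI Hopen_bigU.

Definition Hborel : measurableType _ := g_sigma_algebraType (@open Hspace).

Definition Hbounded (E : set Hspace) : Prop :=
  exists M : R, forall u, E u -> Hnorm u <= M.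

End PhaseSpace.

Section Cylindrical.
Context {R : realType}.

Definition C1 (m : nat) (psi : 'rV[R]_m -> R) : Prop :=
  (forall x, differentiable psi x) /\ forall v, continuous ('D_v psi).

(* Data for the cylindrical function l |-> psi (<l, w_1>, .., <l, w_m>) on the
   dual of the subspace S of Y. *)
Record cylindrical (Y : lmodType R) (S : set Y) := Cylindrical {
  cyl_dim : nat;
  cyl_vec : 'I_cyl_dim -> Y;
  cyl_fun : 'rV[R]_cyl_dim -> R;
  cyl_vecP : forall j, S (cyl_vec j);
  cyl_C1 : C1 cyl_fun;
  cyl_supp : compact (closure [set x | cyl_fun x != 0]) }.
Arguments cyl_vec {Y S} c j.
Arguments cyl_fun {Y S} c x.

Definition cyl_coord (Y : lmodType R) (S : set Y) (Psi : cylindrical S)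
  (l : Y -> R) : 'rV[R]_(cyl_dim Psi) := \row_j l (cyl_vec Psi j).

Definition cyl_eval (Y : lmodType R) (S : set Y) (Psi : cylindrical S)
  (l : Y -> R) : R := cyl_fun Psi (cyl_coord Psi l).

(* The derivative of cyl_eval Psi at l, an element of S. *)
Definition cyl_deriv (Y : lmodType R) (S : set Y) (Psi : cylindrical S)
    (l : Y -> R) : Y :=
  \sum_j 'D_(delta_mx 0 j) (cyl_fun Psi) (cyl_coord Psi l) *: cyl_vec Psi j.

End Cylindrical.

Section Solutions.
Context {R : realType} (Omega : set (R3 R)) (nu : R) (f : vfield R -> R).

Definition V : set (Hspace Omega) := [set u | Vfield Omega (Hrepr u)].

Definition F_cyl_W (Psi : cylindrical (Wspace Omega)) (u : Hspace Omega) : R :=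
  F_W Omega nu f (Hrepr u) (cyl_deriv Psi (H_to_Wdual Omega (Hrepr u))).

Definition F_cyl_V (Psi : cylindrical (Vfield Omega)) (u : Hspace Omega) : R :=
  F_V Omega nu f (Hrepr u) (cyl_deriv Psi (H_to_Vdual Omega (Hrepr u))).

Definition enstrophy (u : Hspace Omega) : \bar R :=
  if u \in V then (ip_grad Omega (Hrepr u) (Hrepr u))%:E else +oo%E.

Definition weak_sss (mu : probability (Hborel Omega) R) : Prop :=
  forall Psi : cylindrical (Wspace Omega),
    mu.-integrable setT (EFin \o F_cyl_W Psi) /\
    (\int[mu]_u (F_cyl_W Psi u)%:E = 0)%E.

(* The functions psi of the energy inequality. A C^1 function on [0, +oo[ is
   the restriction of a C^1 function on R; only its values and derivative on
   [0, +oo[ are used. *)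
Definition energy_weight (psi : R -> R) : Prop :=
  [/\ (forall x, derivable psi x 1) /\ continuous (derive1 psi),
      forall x, 0 <= x -> 0 <= psi x,
      forall x y, 0 <= x -> x <= y -> psi x <= psi y &
      exists C : R, forall x, 0 <= x -> `|derive1 psi x| <= C].

(* That mu is carried by V follows from the finiteness of the first integral
   because V is a Borel subset of H; it is recorded explicitly. *)
Definition foias_prodi_sss (mu : probability (Hborel Omega) R) : Prop :=
  [/\ (\int[mu]_u enstrophy u < +oo)%E /\ mu.-negligible (~` V),
      (forall psi : R -> R, energy_weight psi ->
        (\int[mu]_(u in V)
           (derive1 psi (Hnorm u ^+ 2) *
            (nu * ip_grad Omega (Hrepr u) (Hrepr u) - f (Hrepr u)))%:E <= 0)%E) &
      (forall Psi : cylindrical (Vfield Omega),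
        (\int[mu]_(u in V) (F_cyl_V Psi u)%:E = 0)%E)].

Definition carried_by (E : set (Hspace Omega))
  (mu : probability (Hborel Omega) R) : Prop := mu (~` E) = 0%E.

Definition P_wsss (E : set (Hspace Omega)) : set (probability (Hborel Omega) R) :=
  [set mu | weak_sss mu /\ carried_by E mu].

Definition P_fpsss (E : set (Hspace Omega)) : set (probability (Hborel Omega) R) :=
  [set mu | foias_prodi_sss mu /\ carried_by E mu].

End Solutions.

(* Main.v *)
Require Import Defs.
From HB Require Import structures.
From mathcomp Require Import all_boot all_order all_algebra.
From mathcomp Require Import all_classical all_reals all_analysis.
From mathcomp Require Import measurable_realfun ring lra.
Import Order.TTheory GRing.Theory Num.Theory numFieldNormedType.Exports.
Set Implicit Arguments.
Unset Strict Implicit.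
Unset Printing Implicit Defensive.
Local Open Scope classical_set_scope.
Local Open Scope ring_scope.

(* The upper bound holds because the integral of <F(u), Psi'(u)> against a weak
   stationary statistical solution vanishes: integrating
   phi <= sup_E (phi + <F, Psi'>) - <F, Psi'> over E gives it at once.

   The lower bound is the inclusion of the Foias-Prodi solutions in the weak
   ones. For u in V and w in W, <F(u), w> is the same in V' and in W', that is,
   b(u, w, u) = - b(u, u, w). This is a double density argument: for fixed test
   function phi, div u = 0 tested on phi psi extends from test functions psi to
   psi = w_i by the definition of H^1_0, and the result extends from phi to u_i
   because w and its gradient are bounded; no Sobolev embedding is needed.
   Integrability on the bounded set E follows from the estimate
   |<F(u), w>| <= C (1 + |u| + |u|^2) and from the continuity of <F(.), w> on H.
   Since wpartial is only some L^2 representative of the weak derivative, all of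
   this rests on the du Bois-Reymond lemma, proved by approximating indicators
   of boxes by products of functions exp(-1/(n t)). *)

(** * Boxes in R^3 *)

Section Boxes.
Context {R : realType}.
Implicit Types (a b x : R3 R) (O : set (R3 R)).

(** [E] is bounded but in general not compact, so a continuous [phi] may be unbounded on it and fail
    to be integrable. Its integral is then the extended real int phi^+ - int phi^-, equal to -oo
    when both parts are infinite. This convention is monotone, which is enough for the upper bound:
    the function that dominates [phi] is a constant minus the integrable <F, Psi'>.

    The Foias-Prodi conditions integrate over V, the weak one over all of H. The proof passes from
    one to the other through the negligible complement of V, without a measurability argument for V
    itself.

    Psi'(u) is a linear combination of the w_j with coefficients depending on u. Continuity and
    bounds are available for one w at a time, so F(u) has to be shown linear in w first. This is
    where the choice of representatives hurts: [wpartial] is linear only almost everywhere, and W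
    must be shown stable under linear combinations. *)

Definition box a b : set (R3 R) :=
  [set x | [/\ a.1.1 < x.1.1 < b.1.1, a.1.2 < x.1.2 < b.1.2 & a.2 < x.2 < b.2]].

Definition cbox a b : set (R3 R) :=
  [set x | [/\ a.1.1 <= x.1.1 <= b.1.1, a.1.2 <= x.1.2 <= b.1.2 &
               a.2 <= x.2 <= b.2]].

Lemma box_cbox a b : box a b `<=` cbox a b.
Proof.
by move=> x [/andP[? ?] /andP[? ?] /andP[? ?]]; split; rewrite !ltW.
Qed.

Lemma boxE a b : box a b =
  (`]a.1.1, b.1.1[%classic `*` `]a.1.2, b.1.2[%classic) `*` `]a.2, b.2[%classic.
Proof.
by apply/seteqP; split=> x /=; rewrite !in_itv/= => -[]//; case.
Qed.

Lemma measurable_box a b : measurable (box a b).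
Proof.
rewrite boxE; apply: (measurableX (measurableX _ _) _) => //.
Qed.

Lemma boxI a b a' b' : box a b `&` box a' b' =
  box (Num.max a.1.1 a'.1.1, Num.max a.1.2 a'.1.2, Num.max a.2 a'.2)
      (Num.min b.1.1 b'.1.1, Num.min b.1.2 b'.1.2, Num.min b.2 b'.2).
Proof.
apply/seteqP; split=> x; rewrite /box/= ?gt_max ?lt_min.
  by move=> [[/andP[-> ->] /andP[-> ->] /andP[-> ->]]
    [/andP[-> ->] /andP[-> ->] /andP[-> ->]]].
by move=> [/andP[/andP[-> ->] /andP[-> ->]] /andP[/andP[-> ->] /andP[-> ->]]
  /andP[/andP[-> ->] /andP[-> ->]]].
Qed.

Lemma leb3_box_lty a b : (leb3 (box a b) < +oo)%E.
Proof.
rewrite boxE /leb3.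
have E2 := @product_measure1E _ _ (measurableTypeR R) (measurableTypeR R) R
  lebesgue_measure lebesgue_measure.
have E3 := @product_measure1E _ _ (measurableTypeR R * measurableTypeR R)%type
  (measurableTypeR R) R (lebesgue_measure \x lebesgue_measure)%E
  lebesgue_measure.
have fin (u v : R) : (lebesgue_measure `]u, v[%classic < +oo)%E.
  by rewrite lebesgue_measure_itv/= lte_fin; case: ifP => _; rewrite -?EFinD ltry.
rewrite [X in (X < _)%E]E3//; last exact: measurableX.
rewrite [X in (X * _ < _)%E]E2//.
rewrite lte_mul_pinfty//=; first by rewrite mule_ge0.
  by rewrite fin_numM// ge0_fin_numE.
Qed.

Lemma ballR3 x (e : R) y : ball x e y <->
  [/\ `|x.1.1 - y.1.1| < e, `|x.1.2 - y.1.2| < e & `|x.2 - y.2| < e].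
Proof. by split=> [[[]]|[]]; split. Qed.

(** Boxes with rational corners cover [O]. The closed boxes are kept inside [O] as well, because a
    bump on a box is a test function only if the closed box lies in the domain. *)
Lemma open_boxes O : open O -> exists F : nat -> R3 R * R3 R,
  O = \bigcup_n box (F n).1 (F n).2 /\
  forall n, cbox (F n).1 (F n).2 `<=` O.
Proof.
move=> oO.
pose toR (p : rat * rat * rat) : R3 R := (ratr p.1.1, ratr p.1.2, ratr p.2).
(* Integers that encode no admissible pair of corners get the corners (1,1,1) and (0,0,0), whose box
   is empty, open or closed. *)
pose F n : R3 R * R3 R :=
  if @unpickle ((rat * rat * rat) * (rat * rat * rat))%type n is Some pq
  then if `[< cbox (toR pq.1) (toR pq.2) `<=` O >]
       then (toR pq.1, toR pq.2) else ((1, 1, 1), (0, 0, 0))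
  else ((1, 1, 1), (0, 0, 0)).
have F0 : cbox (1, 1, 1) (0, 0, 0) `<=` O.
  by move=> x [/=]/andP[h1 h2]; have := le_trans h1 h2; rewrite ler10.
have FO n : cbox (F n).1 (F n).2 `<=` O.
  by rewrite /F; case: unpickle => [pq|//]; case: ifPn => // /asboolP.
exists F; split=> //; apply/seteqP; split; last first.
  by move=> x [n _ /box_cbox/FO].
move=> x Ox.
have : nbhs x O by exact: open_nbhs_nbhs.
rewrite -nbhs_ballE => -[e /= e0 eO].
have low (r : R) : exists p : rat, r - e < ratr p < r.
  have /rat_in_itvoo[p] : r - e < r by rewrite ltrBlDr ltrDl.
  by rewrite in_itv/=; exists p.
have upp (r : R) : exists p : rat, r < ratr p < r + e.
  have /rat_in_itvoo[p] : r < r + e by rewrite ltrDl.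
  by rewrite in_itv/=; exists p.
have [p1 p1P] := low x.1.1; have [q1 q1P] := upp x.1.1.
have [p2 p2P] := low x.1.2; have [q2 q2P] := upp x.1.2.
have [p3 p3P] := low x.2; have [q3 q3P] := upp x.2.
exists (pickle ((p1, p2, p3), (q1, q2, q3))) => //.
rewrite /F pickleK asboolT; last first.
  move=> y /= [/andP[y1 y2] /andP[y3 y4] /andP[y5 y6]]; apply: eO.
  move/andP: p1P => [p1a p1b]; move/andP: q1P => [q1a q1b].
  move/andP: p2P => [p2a p2b]; move/andP: q2P => [q2a q2b].
  move/andP: p3P => [p3a p3b]; move/andP: q3P => [q3a q3b].
  have aux (u v p q : R) : u - e < p -> q < u + e -> p <= v -> v <= q ->
      `|u - v| < e.
    by move=> h1 h2 h3 h4; rewrite ltr_norml; apply/andP; split; lra.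
  by apply/ballR3; split; [exact: aux p1a q1b y1 y2|exact: aux p2a q2b y3 y4|
    exact: aux p3a q3b y5 y6].
rewrite /box/=; move/andP: p1P => [_ ->]; move/andP: q1P => [-> _].
move/andP: p2P => [_ ->]; move/andP: q2P => [-> _].
by move/andP: p3P => [_ ->]; move/andP: q3P => [-> _].
Qed.

(** The sigma-algebra of [R3] is the product one, so topology and measurability meet only through
    the countable union of boxes. *)
Lemma open_measurable3 O : open O -> measurable O.
Proof.
move=> /open_boxes[F [-> _]].
by apply: bigcup_measurable => n _; exact: measurable_box.
Qed.

Lemma continuous_measurable3 (f : R3 R -> R) : continuous f ->
  measurable_fun setT f.
Proof.
move=> cf; apply: (measurability _ (RGenOpens.measurableE R)).
move=> _ [_ [a [b ->] <-]].
rewrite setTI; apply: open_measurable3; apply: open_comp => //.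
Qed.

(** Boxes are stable under intersection, so they can serve as generator in a Dynkin induction. For
    the inclusion that takes work, the coordinates are continuous, hence measurable for the
    sigma-algebra of boxes, and so is the identity assembled from them. *)
Lemma box_generates : @measurable _ (R3 R) =
  <<s [set B | exists a b, B = box a b] >>.
Proof.
apply/seteqP; split; last first.
  apply: smallest_sub; first exact: sigma_algebra_measurable.
  by move=> _ [a [b ->]]; exact: measurable_box.
set G := [set B | _]; set S := <<s G >>.
have Sopen O : open O -> S O.
  move=> /open_boxes[F [-> _]].
  apply: sigma_algebra_bigcup => n; apply: sub_sigma_algebra.
  by exists (F n).1, (F n).2.
have Sfun (h : R3 R -> R) : continuous h ->
    measurable_fun setT (h : g_sigma_algebraType G -> measurableTypeR R).
  move=> ch; apply: (measurability _ (RGenOpens.measurableE R)).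
  move=> _ [_ [a [b ->] <-]].
  rewrite setTI; apply: Sopen.
  exact: (@open_comp _ _ h `]a, b[%classic (fun x _ => ch x)).
move=> A mA.
have c1 : continuous (fun x : R3 R => x.1.1).
  move=> x; apply: (@cvg_comp _ _ _ fst fst _ _ _ cvg_fst); exact: cvg_fst.
have c2 : continuous (fun x : R3 R => x.1.2).
  move=> x; apply: (@cvg_comp _ _ _ fst snd _ _ _ cvg_fst); exact: cvg_snd.
have c3 : continuous (fun x : R3 R => x.2) by move=> x; exact: cvg_snd.
have /(_ measurableT A mA) := measurable_fun_pair
  (measurable_fun_pair (Sfun _ c1) (Sfun _ c2)) (Sfun _ c3).
rewrite setTI; congr (S _).
by apply/seteqP; split=> -[[]].
Qed.
End Boxes.

(** * Smooth functions *)

Section Smooth.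
Context {R : realType}.
Implicit Types (f g : R3 R -> R) (t : R).

(** [smooth] only speaks of derivatives along the coordinate directions, so one-variable calculus on
    lines suffices. *)
Lemma is_derive_line f (x v : R3 R) (d : R) :
  is_derive (0 : R) 1 (fun h => f (h *: v + x)) d -> is_derive x v f d.
Proof.
move=> [df <-]; split; first exact/derivable1P.
rewrite /derive; set F := (X in _ = lim (X @ _)); set G := (X in lim (X @ _) = _).
suff -> : G = F by []; rewrite funeqE => h; rewrite /F /G /=.
by rewrite scale0r addr0 add0r [h%:A]mulr1.
Qed.

Lemma CkD n f g : Ck n f -> Ck n g -> Ck n (f \+ g).
Proof.
elim: n f g => [|n IH] f g /=.
  by move=> cf cg x; apply: (@continuousD _ _ _ f g); [exact: cf|exact: cg].
move=> [df pf] [dg pg]; split=> [x j|j]; first exact: derivableD.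
rewrite (_ : partial j _ = partial j f \+ partial j g); first exact: IH.
by apply/funext => x; rewrite /partial deriveD.
Qed.

Lemma CkZ n (c : R) f : Ck n f -> Ck n (fun x => c * f x).
Proof.
elim: n f => [|n IH] f /=.
  by move=> cf x; apply: continuousM; [exact: cvg_cst|exact: cf].
move=> [df pf]; split=> [x j|j].
  exact: (@derivableZ _ _ _ f c).
rewrite (_ : partial j _ = fun x => c * partial j f x); first exact: IH.
by apply/funext => x; rewrite /partial (@deriveZ _ _ _ f c).
Qed.

Lemma smooth_continuous f : smooth f -> continuous f.
Proof. by move=> /(_ 0%N). Qed.

Lemma smooth_derivable f j x : smooth f -> derivable f x (dirv j).
Proof. by move=> /(_ 1%N)[]. Qed.

Lemma smooth_partial f j : smooth f -> smooth (partial j f).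
Proof. by move=> sf n; have [_ pf] := sf n.+1; exact: pf. Qed.

Lemma smoothD f g : smooth f -> smooth g -> smooth (f \+ g).
Proof. by move=> sf sg n; exact: CkD. Qed.

Lemma smoothZ c f : smooth f -> smooth (fun x => c * f x).
Proof. by move=> sf n; exact: CkZ. Qed.

Lemma partialM f g j x : smooth f -> smooth g ->
  partial j (fun x => f x * g x) x = f x * partial j g x + g x * partial j f x.
Proof. by move=> sf sg; rewrite /partial deriveM//; exact: smooth_derivable. Qed.

Lemma smoothM f g : smooth f -> smooth g -> smooth (fun x => f x * g x).
Proof.
move=> sf sg n; elim: n f g sf sg => [|n IH] f g sf sg /=.
  by move=> x; apply: continuousM; exact: smooth_continuous.
split=> [x j|j]; first by apply: derivableM; exact: smooth_derivable.
rewrite (_ : partial j _ =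
    (fun x => f x * partial j g x) \+ (fun x => g x * partial j f x)).
  by apply: CkD; apply: IH => //; exact: smooth_partial.
by apply/funext => x; rewrite partialM.
Qed.

(* The factor t^-k makes the family closed under differentiation, up to linear
   combinations. *)
Definition ebump k t : R := if 0 < t then t^-1 ^+ k * expR (- t^-1) else 0.

Lemma ebump0 k t : t <= 0 -> ebump k t = 0.
Proof. by rewrite /ebump leNgt => /negbTE ->. Qed.

Lemma ebump_ge0 k t : 0 <= ebump k t.
Proof.
rewrite /ebump; case: ifP => // t0.
by rewrite mulr_ge0 ?exprn_ge0 ?expR_ge0// invr_ge0 ltW.
Qed.

(** With s = 1/t this is s^k <= k! exp(s), from a single term of the exponential series. *)
Lemma ebump_le k t : ebump k t <= k`!%:R.
Proof.
rewrite /ebump; case: ifP => // t0.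
rewrite expRN ler_pdivrMr ?expR_gt0//.
have s0 : 0 <= t^-1 by rewrite invr_ge0 ltW.
case: k => [|k]; first by rewrite expr0 mul1r (le_trans _ (expR_ge1Dx _))// lerDl.
rewrite mulrC -ler_pdivrMr ?ltr0n ?fact_gt0//.
by rewrite (le_trans _ (expR_ge1Dxn k s0))// lerDr.
Qed.

Lemma ebumpS2 k t : ebump k t = t ^+ 2 * ebump k.+2 t.
Proof.
rewrite /ebump; case: ifP => t0; last by rewrite mulr0.
rewrite mulrA; congr (_ * _); rewrite -[k.+2]addn2 exprD mulrCA.
by rewrite -[X in _ = _ * X]exprMn mulfV ?gt_eqF// expr1n mulr1.
Qed.

Lemma is_derive_ebump k t :
  is_derive t 1 (ebump k) (ebump k.+2 t - k%:R * ebump k.+1 t).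
Proof.
have [t0|t0|->] := ltgtP t 0.
- rewrite !ebump0 ?ltW// mulr0 subr0.
  apply: (@near_eq_is_derive _ _ _ (cst 0)).
  by near=> s; rewrite ebump0// ltW//; near: s; exact: lt_nbhsl.
- apply: (@near_eq_is_derive _ _ _
    (fun s : R => s^-1 ^+ k * expR (- s^-1))).
    near=> s; rewrite /ebump ifT//.
    by near: s; exact: lt_nbhsr.
  have t1 : t != 0 by rewrite gt_eqF.
  have dV : is_derive t 1 (fun s : R => s^-1) (- t ^- 2).
    have := @is_deriveV _ id t 1 1 t1 (is_derive_id _ _).
    by rewrite [_ *: _]mulr1.
  have dE : is_derive t 1 (fun s : R => expR (- s^-1))
      (t ^- 2 * expR (- t^-1)).
    have dN : is_derive t 1 (fun s : R => - s^-1) (t ^- 2).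
      by have := is_deriveN dV; rewrite opprK.
    have := @is_derive1_comp _ expR (fun s : R => - s^-1) t _ _ (is_derive_expR _) dN.
    by move=> h; apply: is_derive_eq h _; rewrite mulrC.
  have dX : is_derive t 1 (fun s : R => s^-1 ^+ k) (- (k%:R * t^-1 ^+ k.+1)).
    have := @is_deriveX _ _ (fun s : R => s^-1) k t 1 _ dV.
    case: k => [|k].
      by move=> _; rewrite mul0r oppr0; exact: (is_derive_cst (1 : R) t 1).
    move=> h; rewrite (_ : (fun s : R => s^-1 ^+ k.+1) =
      (fun s : R => s^-1) ^+ k.+1); last by apply/funext => s; rewrite exprfctE.
    apply: is_derive_eq h _.
    rewrite -exprVn [_ *: _](_ : _ = k.+1%:R * t^-1 ^+ k * - t^-1 ^+ 2); last first.
      by rewrite /= -mulr_natl.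
    by rewrite mulrN -mulrA -exprD addn2.
  apply: is_derive_eq (is_deriveM dX dE) _.
  rewrite /ebump t0 -[_ *: _]/(_ * _) -[X in _ + X]/(_ * _) -exprVn.
  by rewrite !exprS expr0; ring.
- rewrite !ebump0// mulr0 subr0.
  (* Caratheodory's criterion at 0: by [ebumpS2] the slope is s * [ebump k.+2 s], which tends to 0
     because [ebump k.+2] is bounded. *)
  apply/is_derive1_caratheodory.
  exists (fun s => s * ebump k.+2 s); split=> [z||].
  + by rewrite (ebump0 k (lexx 0)) !subr0 ebumpS2 expr2 mulrAC.
  + rewrite /prop_for /continuous_at /= mul0r; apply/cvgrPdist_le => e e0.
    have K0 : 0 < k.+2`!%:R :> R by rewrite ltr0n fact_gt0.
    near=> z; rewrite sub0r normrN normrM.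
    rewrite (ger0_norm (ebump_ge0 _ _)).
    rewrite (le_trans (ler_wpM2l _ (ebump_le _ _)))//.
    rewrite -ler_pdivlMr// -[z]subr0 distrC.
    near: z; apply: cvgr_dist_le; [|by rewrite divr_gt0].
    exact: cvg_id.
  + by rewrite mul0r.
Unshelve. all: by end_near. Qed.

Definition lin3 (c x : R3 R) : R := c.1.1 * x.1.1 + c.1.2 * x.1.2 + c.2 * x.2.

Lemma lin3_line c (v x : R3 R) h :
  lin3 c (h *: v + x) = lin3 c v * h + lin3 c x.
Proof.
case: v x => [[v1 v2] v3] [[x1 x2] x3]; rewrite /lin3/=.
rewrite -[h *: v1]/(h * v1) -[h *: v2]/(h * v2) -[h *: v3]/(h * v3); ring.
Qed.

Lemma lin3_continuous c : continuous (lin3 c).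
Proof.
move=> x; rewrite /lin3.
have c1 : (fun x : R3 R => x.1.1) @ x --> x.1.1.
  by apply: (@cvg_comp _ _ _ fst fst _ _ _ cvg_fst); exact: cvg_fst.
have c2 : (fun x : R3 R => x.1.2) @ x --> x.1.2.
  by apply: (@cvg_comp _ _ _ fst snd _ _ _ cvg_fst); exact: cvg_snd.
have c3 : (fun x : R3 R => x.2) @ x --> x.2 by exact: cvg_snd.
by apply: cvgD; [apply: cvgD|]; apply: cvgM => //; exact: cvg_cst.
Qed.

(** The induction on the order of differentiation runs over all [k] at once, since each derivative
    raises [k] by one or two. *)
Lemma smooth_bump_affine k (c : R3 R) (d : R) :
  smooth (fun x => ebump k (lin3 c x + d)).
Proof.
move=> n; elim: n k => [|n IH] k /=.
  move=> x; apply: (@continuous_comp _ _ _ (fun x => lin3 c x + d) (ebump k)).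
    by apply: cvgD; [exact: lin3_continuous|exact: cvg_cst].
  apply/differentiable_continuous/derivable1_diffP.
  by have [] := is_derive_ebump k (lin3 c x + d).
have H x j : is_derive x (dirv j) (fun x => ebump k (lin3 c x + d))
    (lin3 c (dirv j) *
     (ebump k.+2 (lin3 c x + d) - k%:R * ebump k.+1 (lin3 c x + d))).
  apply: is_derive_line.
  rewrite (_ : (fun h => _) =
      ebump k \o (fun h => lin3 c (dirv j) * h + (lin3 c x + d))); last first.
    by apply/funext => h /=; rewrite lin3_line -[LHS]/(ebump k (_ + _ + d)) -addrA.
  have dl : is_derive (0 : R) 1
      (fun h => lin3 c (dirv j) * h + (lin3 c x + d)) (lin3 c (dirv j)).
    apply: is_derive_eq; rewrite addr0.
    by rewrite [LHS]mulr1.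
  have db : is_derive (lin3 c (dirv j) * 0 + (lin3 c x + d)) 1 (ebump k)
      (ebump k.+2 (lin3 c x + d) - k%:R * ebump k.+1 (lin3 c x + d)).
    by rewrite mulr0 add0r; exact: is_derive_ebump.
  rewrite mulrC; exact: (@is_derive1_comp _ (ebump k)
    (fun h => lin3 c (dirv j) * h + (lin3 c x + d)) 0 _ _ db dl).
split=> [x j|j]; first by have [] := H x j.
rewrite (_ : partial j _ = (fun x => lin3 c (dirv j) *
     (((fun x => ebump k.+2 (lin3 c x + d)) \+
        (fun x => (- k%:R) * ebump k.+1 (lin3 c x + d))) x))).
  by apply: CkZ; apply: CkD; [exact: IH|apply: CkZ; exact: IH].
by apply/funext => x; rewrite /partial (@derive_val _ _ _ _ _ _ _ (H x j))/= mulNr.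
Qed.

End Smooth.

(** * Smooth approximation of the indicator of a box *)

Section BoxBump.
Context {R : realType}.
Implicit Types (a b x : R3 R) (t : R).

Lemma ebump0_le1 t : ebump 0 t <= 1.
Proof. by have := ebump_le 0 t. Qed.

Lemma ebump_cvg t : ebump 0 (n.+1%:R * t) @[n --> \oo] --> ((0 < t)%R%:R : R).
Proof.
case: (ltP 0 t) => t0; last first.
  apply: cvg_near_cst; apply: nearW => n; rewrite ebump0//.
  by rewrite mulr_ge0_le0.
rewrite (_ : (fun n => _) = (fun n => expR (- (t^-1 * n.+1%:R^-1)))); last first.
  apply/funext => n; rewrite /ebump mulr_gt0// expr0 mul1r.
  by rewrite invfM mulrC.
rewrite -[X in _ --> X](@expR0 R).
apply: (@cvg_comp _ _ _ (fun n => - (t^-1 * n.+1%:R^-1)) (@expR R) _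
  (nbhs (0 : R))); last exact: continuous_expR.
rewrite -oppr0 -(mulr0 t^-1).
by apply: cvgN; apply: cvgM; [exact: cvg_cst|exact: cvg_harmonic].
Qed.

Definition sidebump n (c : R3 R) (d : R) x : R :=
  ebump 0 (n.+1%:R * (lin3 c x + d)).

Lemma smooth_sidebump n c d : smooth (sidebump n c d).
Proof.
rewrite (_ : sidebump n c d =
    fun x => ebump 0 (lin3 (n.+1%:R *: c) x + n.+1%:R * d)).
  exact: smooth_bump_affine.
apply/funext => x; rewrite /sidebump mulrDr; congr (ebump _ (_ + _)).
case: c x => [[c1 c2] c3] [[x1 x2] x3]; rewrite /lin3/=.
rewrite -[_ *: c1]/(_ * c1) -[_ *: c2]/(_ * c2) -[_ *: c3]/(_ * c3); ring.
Qed.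

(** One factor per face. The product vanishes off the open box, so the indicator is approximated
    from inside and no enlarged box has to fit in the domain. *)
Definition boxbump n a b x : R :=
  sidebump n (1, 0, 0) (- a.1.1) x * sidebump n (-1, 0, 0) b.1.1 x *
  (sidebump n (0, 1, 0) (- a.1.2) x * sidebump n (0, -1, 0) b.1.2 x) *
  (sidebump n (0, 0, 1) (- a.2) x * sidebump n (0, 0, -1) b.2 x).

Let lt100 a x : (0 < lin3 (1, 0, 0) x + - a.1.1) = (a.1.1 < x.1.1).
Proof. by rewrite /lin3/= !mul0r !addr0 mul1r subr_gt0. Qed.
Let lt010 a x : (0 < lin3 (0, 1, 0) x + - a.1.2) = (a.1.2 < x.1.2).
Proof. by rewrite /lin3/= !mul0r add0r !addr0 mul1r subr_gt0. Qed.
Let lt001 a x : (0 < lin3 (0, 0, 1) x + - a.2) = (a.2 < x.2).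
Proof. by rewrite /lin3/= !mul0r !add0r mul1r subr_gt0. Qed.
Let ltN100 b x : (0 < lin3 (-1, 0, 0) x + b.1.1) = (x.1.1 < b.1.1).
Proof. by rewrite /lin3/= !mul0r !addr0 mulN1r addrC subr_gt0. Qed.
Let ltN010 b x : (0 < lin3 (0, -1, 0) x + b.1.2) = (x.1.2 < b.1.2).
Proof. by rewrite /lin3/= !mul0r add0r !addr0 mulN1r addrC subr_gt0. Qed.
Let ltN001 b x : (0 < lin3 (0, 0, -1) x + b.2) = (x.2 < b.2).
Proof. by rewrite /lin3/= !mul0r !add0r mulN1r addrC subr_gt0. Qed.

Lemma boxbump_cvg a b x : boxbump n a b x @[n --> \oo] --> (\1_(box a b) x : R).
Proof.
have -> : \1_(box a b) x =
    (a.1.1 < x.1.1)%R%:R * (x.1.1 < b.1.1)%R%:R *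
    ((a.1.2 < x.1.2)%R%:R * (x.1.2 < b.1.2)%R%:R) *
    ((a.2 < x.2)%R%:R * (x.2 < b.2)%R%:R) :> R.
  rewrite -!natrM !mulnb indicE; congr (_%:R); congr nat_of_bool.
  apply/idP/idP => [/set_mem[-> -> ->]//|/andP[/andP[h1 h2] h3]].
  exact/mem_set.
rewrite -lt100 -lt010 -lt001 -ltN100 -ltN010 -ltN001.
by do ![apply: cvgM]; exact: ebump_cvg.
Qed.

Lemma boxbump_ge0 n a b x : 0 <= boxbump n a b x.
Proof. by do ![apply: mulr_ge0]; exact: ebump_ge0. Qed.

Lemma boxbump_le1 n a b x : boxbump n a b x <= 1.
Proof.
have s01 c d : 0 <= sidebump n c d x <= 1.
  by rewrite ebump_ge0 ebump0_le1.
have M01 (u v : R) : 0 <= u <= 1 -> 0 <= v <= 1 -> 0 <= u * v <= 1.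
  by move=> /andP[u0 u1] /andP[v0 v1]; rewrite mulr_ge0//= mulr_ile1.
suff /andP[] : 0 <= boxbump n a b x <= 1 by [].
rewrite /boxbump; apply: (M01 _ _ (M01 _ _ _ _) _); exact: M01.
Qed.

Lemma boxbump_eq0 n a b x : ~ box a b x -> boxbump n a b x = 0.
Proof.
move=> nb; apply/eqP; rewrite !mulf_eq0 -!orbA; apply/negP => /negP h; apply: nb.
move: h; rewrite !negb_or => /and5P[h1 h2 h3 h4 /andP[h5 h6]].
have pos (t : R) : ebump 0 (n.+1%:R * t) != 0 -> 0 < t.
  by rewrite ltNge; apply: contra_neqN => t0; rewrite ebump0// mulr_ge0_le0.
split; apply/andP; split; [rewrite -lt100|rewrite -ltN100|rewrite -lt010|
  rewrite -ltN010|rewrite -lt001|rewrite -ltN001]; exact: pos.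
Qed.

Lemma smooth_boxbump n a b : smooth (boxbump n a b).
Proof. by do ![apply: smoothM]; exact: smooth_sidebump. Qed.

Lemma cboxE a b : cbox a b =
  (`[a.1.1, b.1.1]%classic `*` `[a.1.2, b.1.2]%classic) `*` `[a.2, b.2]%classic.
Proof.
by apply/seteqP; split=> x /=; rewrite !in_itv/= => -[]//; case.
Qed.

Lemma compact_cbox a b : compact (cbox a b).
Proof.
rewrite cboxE; apply: (@compact_setX (R * R)%type R); last exact: segment_compact.
by apply: compact_setX; exact: segment_compact.
Qed.

Lemma test_boxbump (Omega : set (R3 R)) n a b : cbox a b `<=` Omega ->
  test_function Omega (boxbump n a b).
Proof.
move=> abO.
have ccb : closed (cbox a b).
  apply: compact_closed; last exact: compact_cbox.
  exact: norm_hausdorff.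
have sub : closure [set x | boxbump n a b x != 0] `<=` cbox a b.
  rewrite [X in _ `<=` X](closure_id _).1//; apply: closure_subset => x /= h.
  by apply: box_cbox; apply: contrapT => /boxbump_eq0 => /(_ n)/eqP; exact/negP.
split; first exact: smooth_boxbump.
  by apply: subclosed_compact (@compact_cbox a b) sub; exact: closed_closure.
exact: subset_trans sub abO.
Qed.

End BoxBump.

(** * L^2 functions on a set of finite measure *)

Section L2calculus.
Context {R : realType} (Omega : set (R3 R)).
Hypotheses (mO : measurable Omega) (fO : (leb3 Omega < +oo)%E).
Implicit Types (q r c d : R3 R -> R).

Local Notation integ q := (leb3.-integrable Omega (EFin \o q)).

Lemma integ_meas q : integ q -> measurable_fun Omega q.
Proof. by case/integrableP => /measurable_EFinP. Qed.

Lemma integD q r : integ q -> integ r -> integ (fun x => q x + r x).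
Proof.
move=> iq ir; have := integrableD mO iq ir.
by apply: eq_integrable => // x _.
Qed.

Lemma integZ (k : R) q : integ q -> integ (fun x => k * q x).
Proof.
move=> iq; have := integrableZl mO k iq.
by apply: eq_integrable => // x _.
Qed.

Lemma integ0 : integ (fun=> 0).
Proof. exact: integrable0. Qed.

Lemma eq_integ q r : q =1 r -> integ q -> integ r.
Proof. by move=> /funext ->. Qed.

Lemma integ_sum (I : Type) (s : seq I) (F : I -> R3 R -> R) :
  (forall i, integ (F i)) -> integ (fun x => \sum_(i <- s) F i x).
Proof.
move=> iF; elim: s => [|i s IH].
  by apply: eq_integ integ0 => x; rewrite big_nil.
by apply: eq_integ (integD (iF i) IH) => x; rewrite big_cons.
Qed.

Lemma intOD q r : integ q -> integ r ->
  intO Omega (fun x => q x + r x) = intO Omega q + intO Omega r.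
Proof. by move=> iq ir; rewrite /intO RintegralD. Qed.

Lemma intOB q r : integ q -> integ r ->
  intO Omega (fun x => q x - r x) = intO Omega q - intO Omega r.
Proof. by move=> iq ir; rewrite /intO RintegralB. Qed.

Lemma intOZ (k : R) q : integ q -> intO Omega (fun x => k * q x) = k * intO Omega q.
Proof. by move=> iq; rewrite /intO RintegralZl. Qed.

Lemma intO0 : intO Omega (fun=> 0) = 0.
Proof. by rewrite /intO Rintegral_cst// mul0r. Qed.

Lemma eq_intO q r : (forall x, Omega x -> q x = r x) -> intO Omega q = intO Omega r.
Proof. by move=> qr; apply: eq_Rintegral => x /set_mem; exact: qr. Qed.

Lemma intO_sum (I : Type) (s : seq I) (F : I -> R3 R -> R) :
  (forall i, integ (F i)) ->
  intO Omega (fun x => \sum_(i <- s) F i x) = \sum_(i <- s) intO Omega (F i).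
Proof.
move=> iF; elim: s => [|i s IH].
  by rewrite big_nil -[RHS]intO0; apply: eq_intO => x _; rewrite big_nil.
rewrite big_cons -IH -intOD//; last exact: integ_sum.
by apply: eq_intO => x _; rewrite big_cons.
Qed.

Lemma intO_ge0 q : (forall x, Omega x -> 0 <= q x) -> 0 <= intO Omega q.
Proof. exact: Rintegral_ge0. Qed.

Lemma le_intO q r : integ q -> integ r -> (forall x, Omega x -> q x <= r x) ->
  intO Omega q <= intO Omega r.
Proof. exact: le_Rintegral. Qed.

Lemma integ_le q r : measurable_fun Omega q -> integ r ->
  (forall x, Omega x -> `|q x| <= r x) -> integ q.
Proof.
move=> mq ir qr; apply: le_integrable ir => //; first exact/measurable_EFinP.
move=> x Ox; rewrite /= lee_fin (le_trans (qr x Ox))//; exact: ler_norm.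
Qed.

Lemma integ_cst (k : R) : integ (fun=> k).
Proof.
apply/integrableP; split; first exact/measurable_EFinP.
rewrite integral_cst//= lte_mul_pinfty//.
Qed.

Lemma ae_eq_intO q r : measurable_fun Omega q -> measurable_fun Omega r ->
  {ae leb3, forall x, Omega x -> q x = r x} -> intO Omega q = intO Omega r.
Proof.
move=> mq mr qr; congr fine; apply: ae_eq_integral => //.
- exact/measurable_EFinP.
- exact/measurable_EFinP.
- by apply: filterS qr => x qr Ox /=; rewrite qr.
Qed.

Lemma ae_le_integ q r : measurable_fun Omega q -> integ r ->
  (forall x, Omega x -> 0 <= r x) ->
  {ae leb3, forall x, Omega x -> `|q x| <= r x} -> integ q.
Proof.
move=> mq ir r0 qr; apply/integrableP; split; first exact/measurable_EFinP.
have [mr fr] := integrableP _ _ _ ir.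
apply: le_lt_trans fr; apply: ae_ge0_le_integral => //.
- by apply: measurableT_comp => //; exact/measurable_EFinP.
- exact: measurableT_comp.
- apply: filterS qr => x qr Ox; rewrite /= lee_fin (le_trans (qr Ox))//.
  exact: ler_norm.
Qed.

Lemma L2_meas q : L2 Omega q -> measurable_fun Omega q. Proof. by case. Qed.

Lemma L2M q r : L2 Omega q -> L2 Omega r -> integ (fun x => q x * r x).
Proof.
move=> [mq iq] [mr ir]; apply: (@integ_le _ (fun x => q x ^+ 2 + r x ^+ 2)).
- exact: measurable_funM.
- exact: (integD (q := fun x => q x ^+ 2) (r := fun x => r x ^+ 2)).
- by move=> x _; rewrite ler_norml; apply/andP; split; nra.
Qed.

Lemma L2_integ q : L2 Omega q -> integ q.
Proof.
move=> [mq iq]; apply: (@integ_le _ (fun x => 1 + q x ^+ 2)) => //.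
  exact: (integD (q := fun=> 1) (r := fun x => q x ^+ 2) (integ_cst 1)).
by move=> x _; rewrite ler_norml; apply/andP; split; nra.
Qed.

Lemma L2D q r : L2 Omega q -> L2 Omega r -> L2 Omega (fun x => q x + r x).
Proof.
move=> Lq Lr; have [mq iq] := Lq; have [mr ir] := Lr.
split; first exact: measurable_funD.
have := integD (integD (q := fun x => q x ^+ 2) (r := fun x => r x ^+ 2) iq ir)
  (integZ 2 (L2M Lq Lr)).
by apply: eq_integrable => // x _; rewrite /= sqrrD; congr EFin; ring.
Qed.

Lemma L2Z (k : R) q : L2 Omega q -> L2 Omega (fun x => k * q x).
Proof.
move=> [mq iq]; split; first exact: measurable_funM.
have := integZ (k ^+ 2) (q := fun x => q x ^+ 2) iq.
by apply: eq_integrable => // x _; rewrite /= exprMn.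
Qed.

Lemma L2B q r : L2 Omega q -> L2 Omega r -> L2 Omega (fun x => q x - r x).
Proof.
move=> Lq Lr; rewrite (_ : (fun x => _) = fun x => q x + (-1) * r x).
  by apply: L2D => //; exact: L2Z.
by apply/funext => x; rewrite mulN1r.
Qed.

Lemma L2_sqr q : L2 Omega q -> integ (fun x => q x ^+ 2). Proof. by case. Qed.

Lemma L2sq_ge0 q : 0 <= L2sq Omega q.
Proof. by apply: intO_ge0 => x _; exact: sqr_ge0. Qed.

Lemma cauchy_schwarz q r : L2 Omega q -> L2 Omega r ->
  `|intO Omega (fun x => q x * r x)| <=
    Num.sqrt (L2sq Omega q) * Num.sqrt (L2sq Omega r).
Proof.
move=> Lq Lr.
set a := L2sq Omega q; set b := L2sq Omega r; set c := intO _ _.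
have a0 : 0 <= a by exact: L2sq_ge0.
have b0 : 0 <= b by exact: L2sq_ge0.
have H (s t : R) : 0 <= s ^+ 2 * a + 2 * s * t * c + t ^+ 2 * b.
  have := L2sq_ge0 (fun x => s * q x + t * r x); congr (_ <= _).
  rewrite /L2sq (@eq_intO _ (fun x => s ^+ 2 * q x ^+ 2 +
     2 * s * t * (q x * r x) + t ^+ 2 * r x ^+ 2)); last by move=> x _; ring.
  have iq := integZ (s ^+ 2) (L2_sqr Lq); have ir := integZ (t ^+ 2) (L2_sqr Lr).
  have iqr := integZ (2 * s * t) (L2M Lq Lr).
  rewrite intOD//; last exact: integD.
  by rewrite intOD// !intOZ//; [exact: L2_sqr|exact: L2M|exact: L2_sqr].
rewrite -sqrtrM// -(ler_pXn2r (n := 2)) ?nnegrE ?sqrtr_ge0//.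
rewrite sqr_sqrtr ?mulr_ge0// real_normK ?num_real//.
(* If b = 0, the choice s = c, t = -(a + 1) turns [H] into -(a + 2) c^2 >= 0, so c = 0. Otherwise s
   = b, t = -c gives b (a b - c^2) >= 0. *)
have [b1|b1] := eqVneq b 0.
  have := H c (- (a + 1)); rewrite b1 => h; nra.
have bp : 0 < b by rewrite lt_neqAle eq_sym b1.
rewrite -(ler_pM2l bp); have := H b (- c); nra.
Qed.

Lemma Linfty_meas c : Linfty Omega c -> measurable_fun Omega c.
Proof. by case. Qed.

Lemma Linfty_bound c : Linfty Omega c ->
  exists2 M : R, 0 <= M & {ae leb3, forall x, Omega x -> `|c x| <= M}.
Proof.
move=> [_ [M Mc]]; exists `|M| => //.
by apply: filterS Mc => x Mc Ox; rewrite (le_trans (Mc Ox))// ler_norm.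
Qed.

Lemma LinftyD c d : Linfty Omega c -> Linfty Omega d ->
  Linfty Omega (fun x => c x + d x).
Proof.
move=> [mc [M Mc]] [md [N Nd]]; split; first exact: measurable_funD.
exists (M + N); apply: filterS2 Mc Nd => x Mc Nd Ox.
by rewrite (le_trans (ler_normD _ _))// lerD ?Mc ?Nd.
Qed.

Lemma LinftyM c d : Linfty Omega c -> Linfty Omega d ->
  Linfty Omega (fun x => c x * d x).
Proof.
move=> /[dup] /Linfty_meas mc /Linfty_bound[M M0 Mc].
move=> /[dup] /Linfty_meas md /Linfty_bound[N N0 Nd].
split; first exact: measurable_funM.
exists (M * N); apply: filterS2 Mc Nd => x Mc Nd Ox.
by rewrite normrM ler_pM ?Mc ?Nd.
Qed.

Lemma Linfty_cst (k : R) : Linfty Omega (fun=> k).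
Proof. by split => //; exists `|k|; apply: aeW. Qed.

Lemma Linfty_ae c d : Linfty Omega c -> measurable_fun Omega d ->
  {ae leb3, forall x, Omega x -> d x = c x} -> Linfty Omega d.
Proof.
move=> [mc [M Mc]] md dc; split => //; exists M.
by apply: filterS2 Mc dc => x Mc dc Ox; rewrite dc// Mc.
Qed.

Lemma Linfty_L2M c q : Linfty Omega c -> L2 Omega q ->
  L2 Omega (fun x => c x * q x).
Proof.
move=> /[dup] /Linfty_meas mc /Linfty_bound[M M0 Mc] [mq iq].
split; first exact: measurable_funM.
apply: (@ae_le_integ (fun x => (c x * q x) ^+ 2) (fun x => M ^+ 2 * q x ^+ 2)).
- by apply: measurable_funX; exact: measurable_funM.
- exact: (integZ (M ^+ 2) (q := fun x => q x ^+ 2)).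
- by move=> x _; rewrite mulr_ge0// sqr_ge0.
- apply: filterS Mc => x Mc Ox.
  rewrite normrX normrM exprMn; have := Mc Ox => h.
  rewrite real_normK ?num_real// -[q x ^+ 2]real_normK ?num_real//.
  by rewrite ler_wpM2r ?sqr_ge0// -[c x ^+ 2]real_normK ?num_real// lerXn2r ?nnegrE.
Qed.

Lemma Linfty_L2 c : Linfty Omega c -> L2 Omega c.
Proof.
move=> Lc; have L1 : L2 Omega (fun=> 1).
  split => //; have := integ_cst 1.
  by apply: eq_integrable => // x _; rewrite /= expr1n.
by have := Linfty_L2M Lc L1; under eq_fun do rewrite mulr1.
Qed.

Lemma Linfty_L2sq c q M : measurable_fun Omega c -> 0 <= M ->
  {ae leb3, forall x, Omega x -> `|c x| <= M} -> L2 Omega q ->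
  L2sq Omega (fun x => c x * q x) <= M ^+ 2 * L2sq Omega q.
Proof.
move=> mc M0 Mc Lq.
have [mcq icq] : L2 Omega (fun x => c x * q x).
  by apply: Linfty_L2M => //; split=> //; exists M.
rewrite /L2sq -intOZ; last exact: L2_sqr.
have iMq := integZ (M ^+ 2) (L2_sqr Lq).
apply: fine_le; [exact: integrable_fin_num|exact: integrable_fin_num|].
apply: ae_ge0_le_integral => //.
- by move=> x _; rewrite lee_fin sqr_ge0.
- by case/integrableP : icq.
- by move=> x _; rewrite lee_fin mulr_ge0// sqr_ge0.
- by case/integrableP : iMq.
- apply: filterS Mc => x Mc Ox; rewrite lee_fin exprMn ler_wpM2r ?sqr_ge0//.
  by rewrite -[c x ^+ 2]real_normK ?num_real// lerXn2r ?nnegrE//; exact: Mc.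
Qed.

End L2calculus.

(** * Test functions and the du Bois-Reymond lemma *)

Section TestFunctions.
Context {R : realType} (Omega : set (R3 R)).
Implicit Types (phi psi q : R3 R -> R).

Lemma partial_supp phi j : [set x | partial j phi x != 0] `<=`
  closure [set x | phi x != 0].
Proof.
move=> x; apply: contraPP => nx; apply/negP; rewrite negbK; apply/eqP.
rewrite /partial.
have : nbhs x (~` closure [set x | phi x != 0]).
  by apply: open_nbhs_nbhs; split => //; apply: closed_openC; exact: closed_closure.
move=> nbx; rewrite (@near_eq_derive _ _ _ phi (cst 0)) ?derive_cst//.
apply: filterS nbx => y ny; apply/eqP/negP => /negP y0; apply: ny.
exact: subset_closure.
Qed.

Lemma test_partial phi j : test_function Omega phi ->
  test_function Omega (partial j phi).
Proof.
move=> [sphi cphi phiO]; split; first exact: smooth_partial.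
- apply: subclosed_compact cphi _; first exact: closed_closure.
  rewrite [X in _ `<=` X](closure_id _).1; last exact: closed_closure.
  by apply: closure_subset; exact: partial_supp.
- apply: subset_trans phiO.
  rewrite [X in _ `<=` X](closure_id _).1; last exact: closed_closure.
  by apply: closure_subset; exact: partial_supp.
Qed.

Lemma test_smooth phi : test_function Omega phi -> smooth phi.
Proof. by case. Qed.

Lemma test_mul phi psi : test_function Omega phi -> smooth psi ->
  test_function Omega (fun x => phi x * psi x).
Proof.
move=> [sphi cphi phiO] spsi.
have sub : closure [set x | phi x * psi x != 0] `<=`
    closure [set x | phi x != 0].
  by apply: closure_subset => x /=; rewrite mulf_eq0 negb_or => /andP[].
split; first exact: smoothM.
- by apply: subclosed_compact cphi sub; exact: closed_closure.
- exact: subset_trans sub phiO.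
Qed.

Lemma testD phi psi : test_function Omega phi -> test_function Omega psi ->
  test_function Omega (fun x => phi x + psi x).
Proof.
move=> [sphi cphi phiO] [spsi cpsi psiO].
have sub : closure [set x | phi x + psi x != 0] `<=`
    closure [set x | phi x != 0] `|` closure [set x | psi x != 0].
  rewrite -closureU; apply: closure_subset => x /=.
  have [->|?] := eqVneq (phi x) 0; last by left.
  by rewrite add0r; right.
split; first exact: (smoothD sphi spsi).
- by apply: subclosed_compact (compactU cphi cpsi) sub; exact: closed_closure.
- by apply: subset_trans sub _; rewrite subUset.
Qed.

Lemma testZ (k : R) phi : test_function Omega phi ->
  test_function Omega (fun x => k * phi x).
Proof.
move=> [sphi cphi phiO].
have sub : closure [set x | k * phi x != 0] `<=` closure [set x | phi x != 0].
  by apply: closure_subset => x /=; rewrite mulf_eq0 negb_or => /andP[].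
split; first exact: smoothZ.
- by apply: subclosed_compact cphi sub; exact: closed_closure.
- exact: subset_trans sub phiO.
Qed.

Lemma test_bounded phi : test_function Omega phi ->
  exists M : R, forall x, `|phi x| <= M.
Proof.
move=> [sphi cphi _].
have /compact_bounded[M [_ HM]] : compact (phi @` closure [set x | phi x != 0]).
  apply: continuous_compact => //; apply: continuous_subspaceT.
  exact: smooth_continuous.
(* Boundedness provides bounds strictly above [M] only; this one is also nonnegative, as needed
   where [phi] vanishes. *)
exists (`|M| + 1) => x.
have [->|x0] := eqVneq (phi x) 0; first by rewrite normr0 addr_ge0.
have M1 : M < `|M| + 1 by rewrite (le_lt_trans (ler_norm M))// ltrDl.
by apply: (HM _ M1); exists x => //; exact: subset_closure.
Qed.

Lemma test_Linfty phi : test_function Omega phi -> Linfty Omega phi.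
Proof.
move=> tphi; have [M HM] := test_bounded tphi; split.
  apply: measurable_funTS; apply: continuous_measurable3.
  exact/smooth_continuous/test_smooth.
by exists M; apply: aeW.
Qed.

End TestFunctions.

Section Domain.
Context {R : realType} (Omega : set (R3 R)).

Lemma bounded_set_leb3 : measurable Omega -> bounded_set Omega ->
  (leb3 Omega < +oo)%E.
Proof.
move=> mO [M [_ HM]].
pose K : R := `|M| + 1; have /HM HK : M < K.
  by rewrite (le_lt_trans (ler_norm M))// ltrDl.
have sub : Omega `<=` box (- (K + 1), - (K + 1), - (K + 1)) (K + 1, K + 1, K + 1).
  move=> x /HK /= xK.
  have : `|x.1.1| <= K /\ `|x.1.2| <= K /\ `|x.2| <= K.
    move: xK; rewrite {1}/Num.norm/= !ge_max => /andP[/andP[-> ->] ->]//.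
  move=> [h1 [h2 h3]].
  have bd (t : R) : `|t| <= K -> - (K + 1) < t < K + 1.
    rewrite ler_norml => /andP[a b]; apply/andP; split; lra.
  by split; exact: bd.
apply: le_lt_trans (leb3_box_lty _ _); apply: le_measure sub; rewrite inE//.
exact: measurable_box.
Qed.

Lemma domain_measurable : smooth_bounded_domain Omega -> measurable Omega.
Proof. by move=> [oO _ _ _ _]; exact: open_measurable3. Qed.

Lemma domain_finite : smooth_bounded_domain Omega -> (leb3 Omega < +oo)%E.
Proof.
move=> dO; apply: bounded_set_leb3; first exact: domain_measurable.
by case: dO.
Qed.

End Domain.

Section DuBoisReymond.
Context {R : realType} (Omega : set (R3 R)).
Hypothesis oO : open Omega.
Let mO : measurable Omega := open_measurable3 oO.
Variable d : R3 R -> R.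
Hypothesis (id : leb3.-integrable Omega (EFin \o d)).
Hypothesis d0 : forall phi, test_function Omega phi ->
  intO Omega (fun x => d x * phi x) = 0.

(** Dominated convergence along the bumps, with |d| as dominating function: every integral in the
    sequence is zero by hypothesis. *)
Lemma integral_box0 a b : cbox a b `<=` Omega ->
  (\int[leb3]_(x in box a b) (d x)%:E = 0)%E.
Proof.
move=> abO.
have bO : box a b `<=` Omega by apply: subset_trans abO; exact: box_cbox.
have md : measurable_fun Omega d by exact: integ_meas.
have mb n : measurable_fun Omega (boxbump n a b).
  apply: measurable_funTS; apply: continuous_measurable3.
  exact/smooth_continuous/smooth_boxbump.
have mi : measurable_fun Omega (\1_(box a b) : R3 R -> R).
  by apply: measurable_funTS; exact: measurable_indic (measurable_box a b).
have [||||| _ _ cv] := @dominated_convergence _ _ _ leb3 Omega mO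
  (fun n x => (d x * boxbump n a b x)%:E)
  (fun x => (d x * \1_(box a b) x)%:E) (fun x => `|d x|%:E).
- by move=> n; apply/measurable_EFinP; exact: measurable_funM.
- by apply/measurable_EFinP; exact: measurable_funM.
- apply: aeW => x _; apply: cvg_EFin.
    by apply: nearW.
  by apply: cvgM; [exact: cvg_cst|exact: boxbump_cvg].
- exact: integrable_norm.
- apply: aeW => x n _; rewrite lee_fin normrM ler_piMr//.
  by rewrite ger0_norm ?boxbump_ge0 ?boxbump_le1.
have z n : (\int[leb3]_(x in Omega) (d x * boxbump n a b x)%:E = 0)%E.
  have := d0 (@test_boxbump _ Omega n a b abO).
  rewrite /intO /Rintegral => h; rewrite -[LHS]fineK ?h//.
  apply: integrable_fin_num => //.
  apply: (@integ_le _ _ mO (fun x => d x * boxbump n a b x) (fun x => `|d x|)).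
  - exact: measurable_funM.
  - exact: integrable_norm.
  - move=> x _; rewrite normrM ler_piMr//.
    by rewrite ger0_norm ?boxbump_ge0 ?boxbump_le1.
have {cv} : ((fun=> 0%E : \bar R) : nat -> \bar R) @ \oo -->
    (\int[leb3]_(x in Omega) (d x * \1_(box a b) x)%:E)%E.
  rewrite (_ : (fun=> 0%E) =
    fun n => (\int[leb3]_(x in Omega) (d x * boxbump n a b x)%:E)%E) //.
  by apply/funext => n; rewrite z.
move=> /cvg_lim => /(_ (@ereal_hausdorff R)); rewrite lim_cst// => cv.
rewrite -[box a b](setIidr bO) integral_mkcondr [RHS]cv.
apply: eq_integral => x _; rewrite patchE indicE.
by case: ifP => _; rewrite ?mulr1// mulr0.
Qed.

(** Dynkin induction on [A] inside a fixed box. The localization matters because a generating box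
    need not lie in Omega, whereas its intersection with the fixed box does; stability under
    complement comes from the zero integral over the fixed box. *)
Lemma integral_box_setI0 a b (A : set (R3 R)) : cbox a b `<=` Omega ->
  measurable A -> (\int[leb3]_(x in A `&` box a b) (d x)%:E = 0)%E.
Proof.
move=> abO.
have bO : box a b `<=` Omega by apply: subset_trans abO; exact: box_cbox.
have mB := measurable_box a b.
have iB : leb3.-integrable (box a b) (EFin \o d) by exact: integrableS id.
have iA S : measurable S -> leb3.-integrable (S `&` box a b) (EFin \o d).
  by move=> mS; apply: integrableS iB => //; exact: measurableI.
rewrite (@box_generates R).
apply: (@dynkin_induction _ (R3 R) [set B | exists a b, B = box a b]
  (fun A => (\int[leb3]_(x in A `&` box a b) (d x)%:E = 0)%E)).
- exact: box_generates.
- by move=> _ _ [a1 [b1 ->]] [a2 [b2 ->]]; rewrite boxI; do 2 eexists.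
- by rewrite setTI; exact: integral_box0.
- move=> _ [a1 [b1 ->]]; rewrite boxI; apply: integral_box0.
  apply: subset_trans abO; rewrite /cbox/= => x /=.
  rewrite !ge_max !le_min.
  by move=> [/andP[/andP[_ ->] /andP[_ ->]] /andP[/andP[_ ->] /andP[_ ->]]
    /andP[/andP[_ ->] /andP[_ ->]]].
- move=> S mS S0.
  have := integral_box0 abO.
  rewrite -[X in (\int[_]_(x in X) _)%E](setTI (box a b)) -(setUv S) setIUl.
  rewrite integral_setU//; last 4 first.
  + exact: measurableI.
  + by apply: measurableI => //; exact: measurableC.
  + by rewrite -setIUl setUv setTI; case/integrableP : iB.
  + by rewrite disj_set2E setIACA setICr set0I.
  by rewrite S0 add0e.
- move=> F mF tF F0; rewrite setI_bigcupl integral_bigcup.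
  + by rewrite eseries0// => i _ _; exact: F0.
  + exact: trivIset_setIr.
  + by move=> k; exact: measurableI.
  + rewrite -setI_bigcupl; apply: iA; exact: bigcup_measurable.
Qed.

Lemma du_bois_reymond : {ae leb3, forall x, Omega x -> d x = 0}.
Proof.
have [F [FO FcO]] := open_boxes oO.
have H n : {ae leb3, forall x, box (F n).1 (F n).2 x -> d x = 0}.
  have bO : box (F n).1 (F n).2 `<=` Omega.
    by apply: subset_trans (FcO n); exact: box_cbox.
  have mB := @measurable_box R (F n).1 (F n).2.
  have iB : leb3.-integrable (box (F n).1 (F n).2) (EFin \o d).
    exact: integrableS id.
  have := @integral_ae_eq _ _ _ leb3 _ mB (cst 0%E) (EFin \o d) iB.
  move=> /(_ (measurable_cst _)) h.
  suff : ae_eq leb3 (box (F n).1 (F n).2) (EFin \o d) (cst 0%E).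
    by apply: filterS => x dx Bx; have [] := dx Bx.
  apply: h => A AB mA.
  rewrite integral0 -(setIidl AB).
  exact: integral_box_setI0.
have := ae_foralln H; apply: filterS => x dx; rewrite FO => -[n _ Bx].
exact: dx Bx.
Qed.

End DuBoisReymond.

(** * Weak derivatives *)

Section WeakDerivatives.
Context {R : realType} (Omega : set (R3 R)).
Hypotheses (oO : open Omega) (fO : (leb3 Omega < +oo)%E).
Let mO : measurable Omega := open_measurable3 oO.
Implicit Types (q r d e : R3 R -> R) (phi : R3 R -> R) (j : 'I_3).

Local Notation integ q := (leb3.-integrable Omega (EFin \o q)).

Lemma test_L2 phi : test_function Omega phi -> L2 Omega phi.
Proof. by move=> tphi; apply: Linfty_L2 => //; exact: test_Linfty. Qed.

Lemma L2_lin (a : R) q r : L2 Omega q -> L2 Omega r ->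
  L2 Omega (fun x => a * q x + r x).
Proof. by move=> Lq Lr; apply: L2D => //; exact: L2Z. Qed.

Lemma weak_partial_unique j q d e : L2 Omega d -> L2 Omega e ->
  weak_partial Omega j q d -> weak_partial Omega j q e ->
  {ae leb3, forall x, Omega x -> d x = e x}.
Proof.
move=> Ld Le wd we.
have Lde := L2B mO Ld Le.
have : {ae leb3, forall x, Omega x -> d x - e x = 0}; last first.
  by apply: filterS => x H Ox; apply/eqP; rewrite -subr_eq0; apply/eqP; exact: H.
apply: (du_bois_reymond oO (L2_integ mO fO Lde)).
move=> phi tphi; have Lp := test_L2 tphi.
under eq_intO do rewrite mulrBl.
rewrite intOB//; [|exact: L2M|exact: L2M].
by apply/eqP; rewrite subr_eq0 -eqr_opp -wd// we.
Qed.

Lemma wpartialP j q : H1 Omega q ->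
  L2 Omega (wpartial Omega j q) /\ weak_partial Omega j q (wpartial Omega j q).
Proof.
move=> [_ /(_ j)[d Ld wd]].
exact: (@xgetPex _ (fun=> 0) [set d | L2 Omega d /\ weak_partial Omega j q d]
  (ex_intro _ d (conj Ld wd))).
Qed.

Lemma wpartial_L2 j q : H1 Omega q -> L2 Omega (wpartial Omega j q).
Proof. by move=> /(wpartialP j)[]. Qed.

Lemma wpartial_ae j q d : L2 Omega q -> L2 Omega d -> weak_partial Omega j q d ->
  {ae leb3, forall x, Omega x -> wpartial Omega j q x = d x}.
Proof.
move=> Lq Ld wd.
have [Lw ww] := @xgetPex _ (fun=> 0)
  [set d | L2 Omega d /\ weak_partial Omega j q d] (ex_intro _ d (conj Ld wd)).
exact: weak_partial_unique Lw Ld ww wd.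
Qed.

Lemma weak_partial_lin j (a : R) q r d e : L2 Omega q -> L2 Omega r ->
  L2 Omega d -> L2 Omega e ->
  weak_partial Omega j q d -> weak_partial Omega j r e ->
  weak_partial Omega j (fun x => a * q x + r x) (fun x => a * d x + e x).
Proof.
move=> Lq Lr Ld Le wd we phi tphi.
have Lp := test_L2 tphi; have Ldp := test_L2 (test_partial j tphi).
have lin (u v w : R3 R -> R) : L2 Omega u -> L2 Omega v -> L2 Omega w ->
    intO Omega (fun x => (a * u x + v x) * w x) =
    a * intO Omega (fun x => u x * w x) + intO Omega (fun x => v x * w x).
  move=> Lu Lv Lw.
  under eq_intO do rewrite mulrDl -mulrA.
  have := L2M mO Lu Lw; have := L2M mO Lv Lw => iv iu.
  by rewrite intOD ?intOZ//; exact: integZ.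
by rewrite !lin// wd// we// opprD mulrN.
Qed.

Lemma H1_L2 q : H1 Omega q -> L2 Omega q. Proof. by case. Qed.

Lemma H1_lin (a : R) q r : H1 Omega q -> H1 Omega r ->
  H1 Omega (fun x => a * q x + r x).
Proof.
move=> Hq Hr; split=> [|j]; first by apply: L2_lin; exact: H1_L2.
have [Lq wq] := wpartialP j Hq; have [Lr wr] := wpartialP j Hr.
exists (fun x => a * wpartial Omega j q x + wpartial Omega j r x).
  exact: L2_lin.
by apply: weak_partial_lin => //; exact: H1_L2.
Qed.

(** The representative picked by [xget] has no algebraic structure, so linearity comes from
    uniqueness of the weak derivative and holds almost everywhere only. *)
Lemma wpartial_lin j (a : R) q r : H1 Omega q -> H1 Omega r ->
  {ae leb3, forall x, Omega x -> wpartial Omega j (fun x => a * q x + r x) x =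
    a * wpartial Omega j q x + wpartial Omega j r x}.
Proof.
move=> Hq Hr.
have [Lq wq] := wpartialP j Hq; have [Lr wr] := wpartialP j Hr.
apply: wpartial_ae; [|exact: L2_lin|].
- by apply: L2_lin; exact: H1_L2.
- by apply: weak_partial_lin => //; exact: H1_L2.
Qed.

Lemma L2sq_lin (a : R) q r : L2 Omega q -> L2 Omega r ->
  L2sq Omega (fun x => a * q x + r x) <=
    2 * a ^+ 2 * L2sq Omega q + 2 * L2sq Omega r.
Proof.
move=> Lq Lr; have [_ iqr] := L2_lin a Lq Lr.
have iq := integZ mO (2 * a ^+ 2) (L2_sqr Lq); have ir := integZ mO 2 (L2_sqr Lr).
rewrite /L2sq -!intOZ//; [|exact: L2_sqr|exact: L2_sqr].
rewrite -intOD//; apply: le_intO => //; first exact: integD.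
by move=> x _; have := sqr_ge0 (a * q x - r x); nra.
Qed.

Lemma ae_eq_L2sq q r : measurable_fun Omega q -> measurable_fun Omega r ->
  {ae leb3, forall x, Omega x -> q x = r x} -> L2sq Omega q = L2sq Omega r.
Proof.
move=> mq mr qr; apply: ae_eq_intO => //; [exact: measurable_funX..|].
by apply: filterS qr => x qr Ox; rewrite qr.
Qed.

Lemma H10_H1 q : H10 Omega q -> H1 Omega q. Proof. by case. Qed.

Lemma partial_lin j (a : R) phi psi x : smooth phi -> smooth psi ->
  partial j (fun x => a * phi x + psi x) x = a * partial j phi x + partial j psi x.
Proof.
move=> sp sq; rewrite /partial.
rewrite (@deriveD _ _ _ (fun x => a * phi x) psi); last 2 first.
- by apply: (@derivableZ _ _ _ phi a); exact: smooth_derivable.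
- exact: smooth_derivable.
by rewrite (@deriveZ _ _ _ phi a)//; exact: smooth_derivable.
Qed.

Lemma H10_lin (a : R) q r : H10 Omega q -> H10 Omega r ->
  H10 Omega (fun x => a * q x + r x).
Proof.
move=> [Hq Aq] [Hr Ar]; split=> [|e e0]; first exact: H1_lin.
(* [L2sq_lin] then bounds the error by 2 a^2 e1 + 2 e1 = e / 2. *)
pose e1 := e / (4 * (a ^+ 2 + 1)).
have a2 : 0 < a ^+ 2 + 1 by rewrite ltr_wpDl// sqr_ge0.
have e10 : 0 < e1 by rewrite divr_gt0// mulr_gt0.
have e1e : e = e1 * (4 * (a ^+ 2 + 1)) by rewrite /e1 divfK// gt_eqF// mulr_gt0.
have [phi tphi [qphi dqphi]] := Aq _ e10.
have [psi tpsi [rpsi drpsi]] := Ar _ e10.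
have small (u v : R3 R -> R) : L2 Omega u -> L2 Omega v -> L2sq Omega u < e1 ->
    L2sq Omega v < e1 -> L2sq Omega (fun x => a * u x + v x) < e.
  move=> Lu Lv ue ve; apply: le_lt_trans (L2sq_lin a Lu Lv) _.
  have := sqr_ge0 a; nra.
have [Lphi Lpsi] := (test_L2 tphi, test_L2 tpsi).
exists (fun x => a * phi x + psi x); first by apply: testD => //; exact: testZ.
split=> [|j].
  rewrite (_ : (fun x => _) =
    (fun x => a * (q x - phi x) + (r x - psi x))); last first.
    by apply/funext => x; ring.
  by apply: small => //; apply: L2B => //; exact: H1_L2.
have [Ldphi Ldpsi] := (test_L2 (test_partial j tphi), test_L2 (test_partial j tpsi)).
have Lwq := wpartial_L2 j Hq; have Lwr := wpartial_L2 j Hr.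
have Lw := wpartial_L2 j (H1_lin a Hq Hr).
have Ldl := test_L2 (test_partial j (testD (testZ a tphi) tpsi)).
have L1 := L2B mO Lwq Ldphi; have L2' := L2B mO Lwr Ldpsi.
rewrite (@ae_eq_L2sq _ (fun x => a * (wpartial Omega j q x - partial j phi x) +
   (wpartial Omega j r x - partial j psi x))).
- exact: small.
- exact: L2_meas (L2B mO Lw Ldl).
- exact: L2_meas (L2_lin a L1 L2').
- have := wpartial_lin j a Hq Hr; apply: filterS => x wx Ox.
  rewrite wx// partial_lin; [ring|exact: test_smooth tphi|exact: test_smooth tpsi].
Qed.

Lemma W1infty_lin (a : R) q r : W1infty Omega q -> W1infty Omega r ->
  W1infty Omega (fun x => a * q x + r x).
Proof.
have Llin (u v : R3 R -> R) : Linfty Omega u -> Linfty Omega v ->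
    Linfty Omega (fun x => a * u x + v x).
  move=> Lu Lv; apply: LinftyD => //.
  by apply: (LinftyM (c := fun=> a)) => //; exact: Linfty_cst.
move=> [Lq Hq] [Lr Hr]; split=> [|j]; first exact: Llin.
have [d Ld wd] := Hq j; have [e Le we] := Hr j.
exists (fun x => a * d x + e x); first exact: Llin.
by apply: weak_partial_lin => //; exact: Linfty_L2.
Qed.

(** The bounded derivative given by [W1infty] is in L^2 because Omega has finite measure, so
    uniqueness transfers its bound to the representative [wpartial]. *)
Lemma W1infty_wpartial j q : W1infty Omega q -> Linfty Omega (wpartial Omega j q).
Proof.
move=> [Lq /(_ j)[d Ld wd]].
have [Lw _] := @xgetPex _ (fun=> 0)
  [set d | L2 Omega d /\ weak_partial Omega j q d]
  (ex_intro _ d (conj (Linfty_L2 mO fO Ld) wd)).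
exact: Linfty_ae Ld (L2_meas Lw)
  (wpartial_ae (Linfty_L2 mO fO Lq) (Linfty_L2 mO fO Ld) wd).
Qed.

End WeakDerivatives.

(** * Spaces of vector fields *)

Section Fields.
Context {R : realType} (Omega : set (R3 R)).
Hypotheses (oO : open Omega) (fO : (leb3 Omega < +oo)%E).
Let mO : measurable Omega := open_measurable3 oO.
Implicit Types (u v w : vfield R) (q r : R3 R -> R).

Local Notation integ q := (leb3.-integrable Omega (EFin \o q)).
Local Notation I := (intO Omega).
Local Notation D := (wpartial Omega).

Definition L2field u := forall i, L2 Omega (u i).

Lemma Hfield_L2 u : Hfield Omega u -> L2field u. Proof. by case. Qed.

Lemma Vfield_Hfield u : Vfield Omega u -> Hfield Omega u. Proof. by case. Qed.

Lemma Vfield_H10 u : Vfield Omega u -> forall i, H10 Omega (u i).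
Proof. by case. Qed.

Lemma Vfield_H1 u : Vfield Omega u -> forall i, H1 Omega (u i).
Proof. by move=> Vu i; exact/H10_H1/Vfield_H10. Qed.

Lemma L2field_lin (a : R) u v : L2field u -> L2field v -> L2field (a *: u + v).
Proof. by move=> Lu Lv i; exact: (L2_lin oO a (Lu i) (Lv i)). Qed.

Lemma intO_lin (a : R) q r s : L2 Omega q -> L2 Omega r -> L2 Omega s ->
  I (fun x => (a * q x + r x) * s x) =
  a * I (fun x => q x * s x) + I (fun x => r x * s x).
Proof.
move=> Lq Lr Ls; under eq_intO do rewrite mulrDl -mulrA.
have iq := L2M mO Lq Ls; have ir := L2M mO Lr Ls.
by rewrite intOD ?intOZ//; exact: integZ.
Qed.

Lemma intO_dot u v : L2field u -> L2field v ->
  I (fun x => \sum_i u i x * v i x) = \sum_i I (fun x => u i x * v i x).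
Proof. by move=> Lu Lv; rewrite intO_sum// => i; exact: L2M. Qed.

(** Stated on the integral itself so that it also applies to [divergence_free] and
    [zero_normal_trace], with a gradient as [w]. *)
Lemma ip_lin (a : R) u v w : L2field u -> L2field v -> L2field w ->
  I (fun x => \sum_i (a *: u + v) i x * w i x) =
  a * I (fun x => \sum_i u i x * w i x) + I (fun x => \sum_i v i x * w i x).
Proof.
move=> Lu Lv Lw; rewrite !intO_dot//; last exact: L2field_lin.
rewrite mulr_sumr -big_split/=; apply: eq_bigr => i _.
exact: intO_lin.
Qed.

Lemma Hfield_lin (a : R) u v : Hfield Omega u -> Hfield Omega v ->
  Hfield Omega (a *: u + v).
Proof.
move=> [Lu du nu] [Lv dv nv]; split; first exact: L2field_lin.
- move=> phi tphi; rewrite (@ip_lin a u v (fun j => partial j phi))//.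
    by rewrite du// dv// mulr0 addr0.
  by move=> j; apply: test_L2 => //; exact: test_partial.
- move=> q Hq; rewrite (@ip_lin a u v (fun j => D j q))//.
    by rewrite nu// nv// mulr0 addr0.
  by move=> j; exact: wpartial_L2.
Qed.

Lemma Vfield_lin (a : R) u v : Vfield Omega u -> Vfield Omega v ->
  Vfield Omega (a *: u + v).
Proof.
move=> [Hu Vu] [Hv Vv]; split; first exact: Hfield_lin.
by move=> i; exact: (H10_lin oO fO a (Vu i) (Vv i)).
Qed.

Lemma ipC u v : ip Omega u v = ip Omega v u.
Proof. by apply: eq_intO => x _; apply: eq_bigr => i _; rewrite mulrC. Qed.

Lemma ip_linl (a : R) u v w : L2field u -> L2field v -> L2field w ->
  ip Omega (a *: u + v) w = a * ip Omega u w + ip Omega v w.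
Proof. exact: ip_lin. Qed.

Lemma ip_linr (a : R) u v w : L2field u -> L2field v -> L2field w ->
  ip Omega w (a *: u + v) = a * ip Omega w u + ip Omega w v.
Proof. by move=> Lu Lv Lw; rewrite ipC ip_linl// ![ip _ w _]ipC. Qed.

Lemma ip_gradC u v : ip_grad Omega u v = ip_grad Omega v u.
Proof.
by apply: eq_intO => x _; apply: eq_bigr => i _; apply: eq_bigr => j _; rewrite mulrC.
Qed.

Lemma ip_gradE u v : Vfield Omega u -> Vfield Omega v ->
  ip_grad Omega u v = \sum_i \sum_j I (fun x => D j (u i) x * D j (v i) x).
Proof.
move=> Vu Vv.
have iD i j : integ (fun x => D j (u i) x * D j (v i) x).
  by apply: L2M => //; apply: wpartial_L2; exact: Vfield_H1.
rewrite /ip_grad intO_sum//; last by move=> i; exact: integ_sum.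
by apply: eq_bigr => i _; rewrite intO_sum.
Qed.

Lemma ip_grad_linl (a : R) u v w : Vfield Omega u -> Vfield Omega v ->
  Vfield Omega w ->
  ip_grad Omega (a *: u + v) w = a * ip_grad Omega u w + ip_grad Omega v w.
Proof.
move=> Vu Vv Vw; have Vs := Vfield_lin a Vu Vv.
rewrite (ip_gradE Vs Vw) (ip_gradE Vu Vw) (ip_gradE Vv Vw).
rewrite mulr_sumr -big_split/=; apply: eq_bigr => i _.
rewrite mulr_sumr -big_split/=; apply: eq_bigr => j _.
have LDu := wpartial_L2 j (Vfield_H1 Vu i); have LDv := wpartial_L2 j (Vfield_H1 Vv i).
have LDw := wpartial_L2 j (Vfield_H1 Vw i).
rewrite -intO_lin//; apply: ae_eq_intO => //.
- have LDs := wpartial_L2 j (Vfield_H1 (Vfield_lin a Vu Vv) i).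
  by apply: measurable_funM; exact: L2_meas.
- by apply: measurable_funM; [exact: L2_meas (L2_lin oO a LDu LDv)|exact: L2_meas].
- have := wpartial_lin oO fO j a (Vfield_H1 Vu i) (Vfield_H1 Vv i).
  by apply: filterS => x Dx Ox; rewrite -Dx.
Qed.

Lemma stokes_in_H_lin (a : R) u v g h : Vfield Omega u -> Vfield Omega v ->
  stokes_in_H Omega u g -> stokes_in_H Omega v h ->
  stokes_in_H Omega (a *: u + v) (a *: g + h).
Proof.
move=> Vu Vv [Hg ug] [Hh vh]; split=> [|w Vw]; first exact: Hfield_lin.
rewrite ip_linl; [|exact: Hfield_L2..|]; last exact/Hfield_L2/Vfield_Hfield.
by rewrite /stokes ip_grad_linl// ug// vh.
Qed.

Lemma Wspace_V p : Wspace Omega p -> Vfield Omega p.1.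
Proof. by case=> -[]. Qed.

Lemma Wspace_lin (a : R) p p' : Wspace Omega p -> Wspace Omega p' ->
  Wspace Omega (a *: p + p').
Proof.
move=> Wp Wp'; have Vp := Wspace_V Wp; have Vp' := Wspace_V Wp'.
case: Wp Wp' => [_ Wp Sp] [_ Wp' Sp'].
have SS := stokes_in_H_lin a Vp Vp' Sp Sp'.
have E1 : (a *: p + p').1 = a *: p.1 + p'.1 by [].
have E2 : (a *: p + p').2 = a *: p.2 + p'.2 by [].
split; rewrite ?E1 ?E2; last exact: SS.
- split; first exact: Vfield_lin Vp Vp'.
  by exists (a *: p.2 + p'.2); exact: SS.
- by move=> i; exact: (W1infty_lin oO fO a (Wp i) (Wp' i)).
Qed.

Lemma Hfield_zero : Hfield Omega 0.
Proof. exact/set_mem/Hfield0. Qed.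

Lemma test0 : test_function Omega (fun=> 0 : R).
Proof.
(* Zero as the bump of an empty box: smoothness and the support conditions come from
   [test_boxbump]. *)
have -> : (fun=> 0) = @boxbump R 0 (1, 1, 1) (0, 0, 0).
  apply/funext => x; rewrite boxbump_eq0// => -[/=/andP[h1 h2] _ _].
  by have := lt_trans h1 h2; rewrite ltr10.
apply: test_boxbump => x [/=/andP[h1 h2] _ _].
by have := le_trans h1 h2; rewrite ler10.
Qed.

Lemma weak_partial0 j : weak_partial Omega j (fun=> 0) (fun=> 0).
Proof.
move=> phi _; under eq_intO do rewrite mul0r.
by under [in RHS]eq_intO do rewrite mul0r; rewrite intO0// oppr0.
Qed.

Lemma Vfield_zero : Vfield Omega 0.
Proof.
split; first exact: Hfield_zero.
move=> i; have L0 : L2 Omega (fun=> 0 : R) by exact: test_L2 test0.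
have D0 j := wpartial_ae oO fO L0 L0 (@weak_partial0 j).
split.
  by split => // j; exists (fun=> 0) => //; exact: weak_partial0.
move=> e e0; exists (fun=> 0); first exact: test0.
have z (q : R3 R -> R) : measurable_fun Omega q ->
    {ae leb3, forall x, Omega x -> q x = 0} -> L2sq Omega q < e.
  move=> mq qx; rewrite (@ae_eq_L2sq _ _ oO q (fun=> 0))//.
  by rewrite /L2sq; under eq_intO do rewrite expr0n/=; rewrite intO0.
split=> [|j]; apply: z => //.
- rewrite (_ : (fun x => _) = cst 0); first exact: measurable_cst.
  by apply/funext => x; rewrite subr0.
- by apply: aeW => x _; rewrite subr0.
- apply: measurable_funB.
    apply: L2_meas; apply: wpartial_L2; split => // k.
    by exists (fun=> 0) => //; exact: weak_partial0.
  exact: L2_meas (test_L2 oO fO (test_partial j test0)).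
- apply: filterS (D0 j) => x Dx Ox; rewrite [X in X - _]Dx// sub0r /partial.
  by rewrite (derive_cst (0 : R)) oppr0.
Qed.

Lemma Wspace0 : Wspace Omega 0.
Proof.
have S0 : stokes_in_H Omega 0 0.
  have V0 := Vfield_zero.
  split=> [|v Vv]; first exact: Hfield_zero.
  have L0 := Hfield_L2 Hfield_zero; have Lv := Hfield_L2 (Vfield_Hfield Vv).
  have -> : ip Omega 0 v = 0.
    have := ip_linl (-1) L0 L0 Lv; rewrite scaleN1r addrC subrr => ->; ring.
  have := ip_grad_linl (-1) V0 V0 Vv; rewrite scaleN1r addrC subrr /stokes => ->.
  ring.
split=> //; first by split; [exact: Vfield_zero|exists 0].
move=> i; split=> [|j]; first exact: test_Linfty test0.
exists (fun=> 0); first exact: test_Linfty test0.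
exact: weak_partial0.
Qed.

Lemma Wspace_sum (n : nat) (c : 'I_n -> R) (p : 'I_n -> vfield R * vfield R) :
  (forall j, Wspace Omega (p j)) -> Wspace Omega (\sum_j c j *: p j).
Proof.
by move=> Wp; elim/big_ind : _ => [|p1 p2 h1 h2|j _];
  [exact: Wspace0| rewrite -[p1]scale1r; exact: Wspace_lin |
   rewrite -[_ *: _]addr0; apply: Wspace_lin => //; exact: Wspace0].
Qed.

End Fields.

(** * The trilinear form *)

Section Trilinear.
Context {R : realType} (Omega : set (R3 R)).
Hypotheses (oO : open Omega) (fO : (leb3 Omega < +oo)%E).
Let mO : measurable Omega := open_measurable3 oO.
Implicit Types (u v w : vfield R) (q r : R3 R -> R).

Local Notation integ q := (leb3.-integrable Omega (EFin \o q)).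
Local Notation I := (intO Omega).
Local Notation D := (wpartial Omega).

(** The sum is continuous in [q] for the H^1 norm because all coefficients are in L^2, so it
    vanishes on the closure of the test functions. Both density steps of the antisymmetry are
    instances, with [q = w i] and [q = v i]. *)
Lemma H10_closure (g h : 'I_3 -> R3 R -> R) q :
  (forall j, L2 Omega (g j)) -> (forall j, L2 Omega (h j)) ->
  (forall psi, test_function Omega psi ->
    \sum_j (I (fun x => g j x * partial j psi x) + I (fun x => h j x * psi x)) = 0) ->
  H10 Omega q ->
  \sum_j (I (fun x => g j x * D j q x) + I (fun x => h j x * q x)) = 0.
Proof.
move=> Lg Lh gh0 [Hq Aq]; set S := \sum_j _.
pose K := \sum_j (Num.sqrt (L2sq Omega (g j)) + Num.sqrt (L2sq Omega (h j))).
have K0 : 0 <= K by apply: sumr_ge0 => j _; rewrite addr_ge0// sqrtr_ge0.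
have bound (e : R) : 0 < e -> `|S| <= K * e.
  (* [H10] controls squared norms, hence the square of [e]. *)
  move=> e0; have [psi tpsi [qpsi dqpsi]] := Aq (e ^+ 2) (exprn_gt0 2 e0).
  have Lq := H1_L2 Hq; have Lpsi := test_L2 oO fO tpsi.
  have LD j : L2 Omega (D j q) by exact: wpartial_L2.
  have LP j : L2 Omega (partial j psi).
    exact: (test_L2 oO fO (test_partial j tpsi)).
  have -> : S = \sum_j (I (fun x => g j x * (D j q x - partial j psi x)) +
                       I (fun x => h j x * (q x - psi x))).
    rewrite -[LHS]subr0 -[X in _ - X](gh0 _ tpsi) /S -sumrB; apply: eq_bigr => j _.
    under [in RHS]eq_intO do rewrite mulrBr.
    under [X in _ = _ + X]eq_intO do rewrite mulrBr.
    rewrite !intOB//; [|exact: L2M..].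
    ring.
  rewrite (le_trans (ler_norm_sum _ _ _))// /K mulr_suml; apply: ler_sum => j _.
  have small r : L2sq Omega r < e ^+ 2 -> Num.sqrt (L2sq Omega r) <= e.
    move=> re; rewrite -[leRHS](ger0_norm (ltW e0)) -sqrtr_sqr.
    by rewrite ler_wsqrtr// ltW.
  have CS (r s : R3 R -> R) : L2 Omega r -> L2 Omega s -> L2sq Omega s < e ^+ 2 ->
      `|I (fun x => r x * s x)| <= Num.sqrt (L2sq Omega r) * e.
    move=> Lr Ls se; apply: le_trans (cauchy_schwarz mO Lr Ls) _.
    by rewrite ler_wpM2l ?sqrtr_ge0// small.
  rewrite mulrDl (le_trans (ler_normD _ _))// lerD//.
    by apply: CS => //; exact: L2B.
  by apply: CS => //; exact: L2B.
apply/eqP; rewrite -normr_eq0; apply/negPn/negP => S0.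
have S1 : 0 < `|S| by rewrite lt_neqAle eq_sym S0/=.
(* For this value e, [bound] says |S| <= K e while |S| = 2 (K + 1) e, a contradiction; the 1 covers
   K = 0. *)
have e0 : 0 < `|S| / (2 * (K + 1)) by rewrite divr_gt0// mulr_gt0// ltr_wpDl.
have := bound _ e0.
have -> : `|S| = (`|S| / (2 * (K + 1))) * (2 * (K + 1)).
  by rewrite divfK// gt_eqF// mulr_gt0// ltr_wpDl.
set e := _ / _ in e0 *; rewrite mulfK ?gt_eqF ?mulr_gt0 ?ltr_wpDl//.
nra.
Qed.

(** [Bform] with the gradient replaced by an arbitrary matrix of coefficients. Linearity in the
    coefficients is then exact, and for bounded coefficients the form is bounded on L^2 fields. *)
Definition trilin (c : 'I_3 -> 'I_3 -> R3 R -> R) u v : R :=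
  I (fun x => \sum_i (\sum_j u j x * c i j x) * v i x).

Lemma trilinE c u v : (forall i j, integ (fun x => u j x * c i j x * v i x)) ->
  trilin c u v = \sum_i \sum_j I (fun x => u j x * c i j x * v i x).
Proof.
move=> iT; rewrite /trilin.
under eq_intO do under eq_bigr do rewrite mulr_suml.
rewrite intO_sum//; last by move=> i; exact: integ_sum.
by apply: eq_bigr => i _; rewrite intO_sum.
Qed.

Lemma antisymmetry u v w : Hfield Omega u -> (forall i, H10 Omega (v i)) ->
  (forall i, H10 Omega (w i)) -> (forall i, W1infty Omega (w i)) ->
  Bform Omega u w v = - Bform Omega u v w.
Proof.
move=> [Lu du _] Hv Hw Ww.
have Lv i := H1_L2 (H10_H1 (Hv i)); have Lw i := H1_L2 (H10_H1 (Hw i)).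
have Bw i : Linfty Omega (w i) by case: (Ww i).
have BD i j : Linfty Omega (D j (w i)) by exact: W1infty_wpartial.
have LDv i j : L2 Omega (D j (v i)) by apply: wpartial_L2; exact: H10_H1.
have LuDw i j : L2 Omega (fun x => D j (w i) x * u j x) by exact: Linfty_L2M.
have Luw i j : L2 Omega (fun x => w i x * u j x) by exact: Linfty_L2M.
have i1 i j : integ (fun x => u j x * D j (w i) x * v i x).
  apply: eq_integ (L2M mO (LuDw i j) (Lv i)) => x; ring.
have i2 i j : integ (fun x => u j x * D j (v i) x * w i x).
  apply: eq_integ (L2M mO (Luw i j) (LDv i j)) => x; ring.
rewrite -[Bform _ u w v]/(trilin (fun i j => D j (w i)) u v).
rewrite -[Bform _ u v w]/(trilin (fun i j => D j (v i)) u w).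
rewrite !trilinE// -sumrN; apply: eq_bigr => i _.
apply/eqP; rewrite -subr_eq0 opprK -big_split/=; apply/eqP.
(* What remains for each component is that u . grad (v_i w_i) has integral zero, expanded by the
   product rule. Here a test function stands in place of v_i. *)
have step1 phi : test_function Omega phi ->
    \sum_j (I (fun x => (phi x * u j x) * D j (w i) x) +
            I (fun x => (partial j phi x * u j x) * w i x)) = 0.
  move=> tphi; have Bphi := test_Linfty tphi.
  have Bdphi j := test_Linfty (test_partial j tphi).
  apply: H10_closure => //.
  - by move=> j; exact: Linfty_L2M.
  - by move=> j; exact: Linfty_L2M.
  move=> psi tpsi.
  have := du _ (test_mul tphi (test_smooth tpsi)).
  have Bpsi := test_Linfty tpsi.
  have Bdpsi j := test_Linfty (test_partial j tpsi).
  rewrite intO_sum//; last first.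
    move=> j; apply: L2M => //; apply: (test_L2 oO fO).
    by apply: test_partial; exact: test_mul tphi (test_smooth tpsi).
  move=> h; rewrite -[RHS]h; apply: eq_bigr => j _.
  rewrite -intOD//; last 2 first.
  - apply: L2M => //; first exact: Linfty_L2M.
    exact: (test_L2 oO fO (test_partial j tpsi)).
  - apply: L2M => //; first exact: Linfty_L2M.
    exact: (test_L2 oO fO tpsi).
  apply: eq_intO => x _; rewrite partialM; first ring.
  - exact: test_smooth tphi.
  - exact: test_smooth tpsi.
have := @H10_closure (fun j x => w i x * u j x) (fun j x => D j (w i) x * u j x)
  (v i) (Luw i) (LuDw i).
move=> /(_ _ (Hv i)) h; rewrite -[RHS]h.
  apply: eq_bigr => j _; rewrite addrC; congr (_ + _); apply: eq_intO => x _; ring.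
move=> psi tpsi; rewrite -[RHS](step1 psi tpsi).
apply: eq_bigr => j _; rewrite addrC; congr (_ + _); apply: eq_intO => x _; ring.
Qed.

End Trilinear.

(** * The functional F(u) on W: agreement with V', linearity and estimates *)

Section WeakForm.
Context {R : realType} (Omega : set (R3 R)).
Hypotheses (oO : open Omega) (fO : (leb3 Omega < +oo)%E).
Let mO : measurable Omega := open_measurable3 oO.
Variables (nu : R) (f : vfield R -> R) (f_dual : V_dual Omega f).
Implicit Types (u v w : vfield R) (p : vfield R * vfield R).

Local Notation integ q := (leb3.-integrable Omega (EFin \o q)).
Local Notation I := (intO Omega).
Local Notation D := (wpartial Omega).

(** The viscous terms agree by the defining property of A w tested against [u], which lies in V; the
    convective terms agree by antisymmetry with [v = u]. *)
Lemma F_W_eq_F_V u p : Vfield Omega u -> Wspace Omega p ->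
  F_W Omega nu f u p = F_V Omega nu f u p.1.
Proof.
move=> Vu Wp; have Vp := Wspace_V Wp; case: Wp => _ Wp [_ Sp].
rewrite /F_W /F_V /stokes ipC Sp// /stokes [ip_grad _ u _]ip_gradC; congr (_ + _).
apply: antisymmetry => //.
- exact: Vfield_Hfield.
- exact: Vfield_H10.
- exact: Vfield_H10.
Qed.

Lemma integ_trilin (c : 'I_3 -> 'I_3 -> R3 R -> R) u v i j :
  (forall i j, Linfty Omega (c i j)) -> L2field Omega u -> L2field Omega v ->
  integ (fun x => u j x * c i j x * v i x).
Proof.
move=> Bc Lu Lv.
apply: eq_integ (L2M mO (Linfty_L2M mO (Bc i j) (Lu j)) (Lv i)) => x; ring.
Qed.

Lemma trilin_lin (a : R) (c d : 'I_3 -> 'I_3 -> R3 R -> R) u v :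
  (forall i j, Linfty Omega (c i j)) -> (forall i j, Linfty Omega (d i j)) ->
  L2field Omega u -> L2field Omega v ->
  trilin Omega (fun i j x => a * c i j x + d i j x) u v =
  a * trilin Omega c u v + trilin Omega d u v.
Proof.
move=> Bc Bd Lu Lv.
have Be i j : Linfty Omega (fun x => a * c i j x + d i j x).
  by apply: LinftyD => //; apply: (LinftyM (c := fun=> a)) => //; exact: Linfty_cst.
rewrite (trilinE oO (fun i j => integ_trilin i j Be Lu Lv))
  (trilinE oO (fun i j => integ_trilin i j Bc Lu Lv))
  (trilinE oO (fun i j => integ_trilin i j Bd Lu Lv)).
rewrite mulr_sumr -big_split/=; apply: eq_bigr => i _.
rewrite mulr_sumr -big_split/=; apply: eq_bigr => j _.
have ic := integ_trilin i j Bc Lu Lv; have id := integ_trilin i j Bd Lu Lv.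
rewrite -intOZ// -intOD//; last exact: integZ.
by apply: eq_intO => x _; ring.
Qed.

Lemma trilin_linl (a : R) (c : 'I_3 -> 'I_3 -> R3 R -> R) u u' v :
  (forall i j, Linfty Omega (c i j)) -> L2field Omega u -> L2field Omega u' ->
  L2field Omega v ->
  trilin Omega c (a *: u + u') v = a * trilin Omega c u v + trilin Omega c u' v.
Proof.
move=> Bc Lu Lu' Lv; have Ls := L2field_lin oO a Lu Lu'.
rewrite (trilinE oO (fun i j => integ_trilin i j Bc Ls Lv))
  (trilinE oO (fun i j => integ_trilin i j Bc Lu Lv))
  (trilinE oO (fun i j => integ_trilin i j Bc Lu' Lv)).
rewrite mulr_sumr -big_split/=; apply: eq_bigr => i _.
rewrite mulr_sumr -big_split/=; apply: eq_bigr => j _.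
have ic := integ_trilin i j Bc Lu Lv; have id := integ_trilin i j Bc Lu' Lv.
rewrite -intOZ// -intOD//; last exact: integZ.
apply: eq_intO => x _; rewrite -[(_ *: u + u') j x]/(a * u j x + u' j x); ring.
Qed.

Lemma trilin_linr (a : R) (c : 'I_3 -> 'I_3 -> R3 R -> R) u v v' :
  (forall i j, Linfty Omega (c i j)) -> L2field Omega u -> L2field Omega v ->
  L2field Omega v' ->
  trilin Omega c u (a *: v + v') = a * trilin Omega c u v + trilin Omega c u v'.
Proof.
move=> Bc Lu Lv Lv'; have Ls := L2field_lin oO a Lv Lv'.
rewrite (trilinE oO (fun i j => integ_trilin i j Bc Lu Ls))
  (trilinE oO (fun i j => integ_trilin i j Bc Lu Lv))
  (trilinE oO (fun i j => integ_trilin i j Bc Lu Lv')).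
rewrite mulr_sumr -big_split/=; apply: eq_bigr => i _.
rewrite mulr_sumr -big_split/=; apply: eq_bigr => j _.
have ic := integ_trilin i j Bc Lu Lv; have id := integ_trilin i j Bc Lu Lv'.
rewrite -intOZ// -intOD//; last exact: integZ.
apply: eq_intO => x _; rewrite -[(_ *: v + v') i x]/(a * v i x + v' i x); ring.
Qed.

Lemma L2sq_le_ip u i : L2field Omega u -> L2sq Omega (u i) <= ip Omega u u.
Proof.
move=> Lu; apply: le_intO => //.
- exact: L2_sqr.
- by apply: integ_sum => // j; exact: L2M.
- move=> x _; rewrite (bigD1 i)//= expr2 lerDl; apply: sumr_ge0 => j _.
  by rewrite -expr2 sqr_ge0.
Qed.

Lemma sqrt_L2sq_le_nrm u i : L2field Omega u ->
  Num.sqrt (L2sq Omega (u i)) <= nrm Omega u.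
Proof. by move=> Lu; apply: ler_wsqrtr; exact: L2sq_le_ip. Qed.

(** Scalar Cauchy-Schwarz in each component, hence the factor 3. It is harmless, since only
    continuity and boundedness are drawn from the estimate. *)
Lemma ip_bound u v : L2field Omega u -> L2field Omega v ->
  `|ip Omega u v| <= 3 * (nrm Omega u * nrm Omega v).
Proof.
move=> Lu Lv; rewrite /ip intO_dot//.
rewrite (le_trans (ler_norm_sum _ _ _))//.
have -> : 3 * (nrm Omega u * nrm Omega v) =
    \sum_(i < 3) nrm Omega u * nrm Omega v.
  by rewrite sumr_const card_ord mulr_natl.
apply: ler_sum => i _; rewrite (le_trans (cauchy_schwarz mO (Lu i) (Lv i)))//.
by rewrite ler_pM ?sqrtr_ge0 ?sqrt_L2sq_le_nrm.
Qed.

Lemma trilin_bound (c : 'I_3 -> 'I_3 -> R3 R -> R) :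
  (forall i j, Linfty Omega (c i j)) ->
  exists2 C : R, 0 <= C & forall u v, L2field Omega u -> L2field Omega v ->
    `|trilin Omega c u v| <= C * (nrm Omega u * nrm Omega v).
Proof.
move=> Bc.
have /choice[M HM] : forall ij : 'I_3 * 'I_3, exists M : R, 0 <= M /\
    {ae leb3, forall x, Omega x -> `|c ij.1 ij.2 x| <= M}.
  by move=> ij; have [M M0 cM] := Linfty_bound (Bc ij.1 ij.2); exists M.
exists (\sum_i \sum_j M (i, j)).
  by apply: sumr_ge0 => i _; apply: sumr_ge0 => j _; have [] := HM (i, j).
move=> u v Lu Lv.
rewrite (trilinE oO (fun i j => integ_trilin i j Bc Lu Lv)).
rewrite mulr_suml (le_trans (ler_norm_sum _ _ _))//; apply: ler_sum => i _.
rewrite mulr_suml (le_trans (ler_norm_sum _ _ _))//; apply: ler_sum => j _.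
have [M0 cM] := HM (i, j); have Lcu := Linfty_L2M mO (Bc i j) (Lu j).
under eq_intO do rewrite [u j _ * _]mulrC.
rewrite (le_trans (cauchy_schwarz mO Lcu (Lv i)))// mulrA.
rewrite ler_pM ?sqrtr_ge0 ?sqrt_L2sq_le_nrm//.
rewrite (le_trans (ler_wsqrtr (Linfty_L2sq mO (Linfty_meas (Bc i j)) M0 cM (Lu j))))//.
by rewrite sqrtrM ?sqr_ge0// sqrtr_sqr ger0_norm// ler_wpM2l// sqrt_L2sq_le_nrm.
Qed.

Lemma W_Linfty p : Wspace Omega p -> forall i j, Linfty Omega (D j (p.1 i)).
Proof. by case=> _ Wp _ i j; exact: W1infty_wpartial. Qed.

Lemma F_W_lin (a : R) u p p' : L2field Omega u -> Wspace Omega p ->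
  Wspace Omega p' ->
  F_W Omega nu f u (a *: p + p') = a * F_W Omega nu f u p + F_W Omega nu f u p'.
Proof.
move=> Lu Wp Wp'; have Vp := Wspace_V Wp; have Vp' := Wspace_V Wp'.
have Bp := W_Linfty Wp; have Bp' := W_Linfty Wp'.
have Bs := W_Linfty (Wspace_lin oO fO a Wp Wp').
have Lp : L2field Omega p.2 by case: Wp => _ _ [/Hfield_L2].
have Lp' : L2field Omega p'.2 by case: Wp' => _ _ [/Hfield_L2].
rewrite /F_W -[(a *: p + p').1]/(a *: p.1 + p'.1).
rewrite -[(a *: p + p').2]/(a *: p.2 + p'.2).
have -> : Bform Omega u (a *: p.1 + p'.1) u =
    a * Bform Omega u p.1 u + Bform Omega u p'.1 u.
  rewrite -[Bform _ u p.1 u]/(trilin Omega (fun i j => D j (p.1 i)) u u).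
  rewrite -[Bform _ u p'.1 u]/(trilin Omega (fun i j => D j (p'.1 i)) u u).
  rewrite -trilin_lin//.
  rewrite -[LHS]/(trilin Omega (fun i j => D j ((a *: p.1 + p'.1) i)) u u).
  have Be i j : Linfty Omega (fun x => a * D j (p.1 i) x + D j (p'.1 i) x).
    by apply: LinftyD => //; apply: (LinftyM (c := fun=> a)) => //; exact: Linfty_cst.
  (* The two coefficient matrices agree only almost everywhere, so the integrals are compared entry
     by entry. *)
  rewrite (trilinE oO (fun i j => integ_trilin i j Bs Lu Lu)).
  rewrite (trilinE oO (fun i j => integ_trilin i j Be Lu Lu)).
  apply: eq_bigr => i _; apply: eq_bigr => j _; apply: ae_eq_intO => //.
  - exact: integ_meas (integ_trilin i j Bs Lu Lu).
  - exact: integ_meas (integ_trilin i j Be Lu Lu).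
  - have := wpartial_lin oO fO j a (Vfield_H1 Vp i) (Vfield_H1 Vp' i).
    by apply: filterS => x Dx Ox; rewrite -Dx.
have fl : f (a *: p.1 + p'.1) = a * f p.1 + f p'.1 by exact: f_dual.1.
rewrite fl (ip_linr oO a Lp Lp' Lu).
set b1 := Bform _ _ _ _; set b2 := Bform _ _ _ _.
set i1 := ip _ _ _; set i2 := ip _ _ _.
ring.
Qed.

Lemma F_W_sum (n : nat) u (c : 'I_n -> R) (p : 'I_n -> vfield R * vfield R) :
  L2field Omega u -> (forall j, Wspace Omega (p j)) ->
  F_W Omega nu f u (\sum_j c j *: p j) = \sum_j c j * F_W Omega nu f u (p j).
Proof.
move=> Lu Wp.
have W0 := Wspace0 oO fO.
have F0 : F_W Omega nu f u 0 = 0.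
  have := F_W_lin (-1) Lu W0 W0; rewrite scaleN1r addrC subrr => ->; ring.
suff [] : Wspace Omega (\sum_j c j *: p j) /\
  F_W Omega nu f u (\sum_j c j *: p j) = \sum_j c j * F_W Omega nu f u (p j) by [].
elim/big_rec2 : _ => [|j x p' _ [Wp' IH]]; first by split.
split; first exact: (Wspace_lin oO fO (c j) (Wp j) Wp').
by rewrite (F_W_lin (c j) Lu (Wp j) Wp') IH.
Qed.

End WeakForm.

(** * Functionals on the phase space *)

Section ContinuousFunctions.
Context {R : realType} {T : topologicalType}.
Implicit Types g h : T -> R.

Lemma continuous_add g h : continuous g -> continuous h ->
  continuous (fun x => g x + h x).
Proof. by move=> cg ch x; apply: cvgD; [exact: cg|exact: ch]. Qed.

Lemma continuous_mul g h : continuous g -> continuous h ->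
  continuous (fun x => g x * h x).
Proof. by move=> cg ch x; apply: cvgM; [exact: cg|exact: ch]. Qed.

Lemma continuous_sum (J : finType) (g : J -> T -> R) :
  (forall j, continuous (g j)) -> continuous (fun x => \sum_j g j x).
Proof.
move=> cg; suff H (s : seq J) : continuous (fun x => \sum_(j <- s) g j x).
  exact: H.
elim: s => [|j s IH].
  rewrite (_ : (fun x => _) = fun=> 0); first exact: cst_continuous.
  by apply/funext => x; rewrite big_nil.
rewrite (_ : (fun x => _) = fun x => g j x + \sum_(j <- s) g j x).
  exact: continuous_add.
by apply/funext => x; rewrite big_cons.
Qed.

End ContinuousFunctions.

Section PhaseSpaceFunctionals.
Context {R : realType} (Omega : set (R3 R)).
Hypotheses (oO : open Omega) (fO : (leb3 Omega < +oo)%E).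
Variables (nu : R) (f : vfield R -> R).
Implicit Types (u v : Hspace Omega) (p : vfield R * vfield R).

Lemma Hrepr_H u : Hfield Omega (Hrepr u).
Proof. by rewrite /Hrepr; exact: set_mem (valP (repr u)). Qed.

Lemma Hrepr_L2 u : L2field Omega (Hrepr u).
Proof. exact/Hfield_L2/Hrepr_H. Qed.

Lemma Hrepr_sub_L2 u v : L2field Omega (Hrepr u - Hrepr v).
Proof.
by rewrite addrC -scaleN1r; apply: (L2field_lin oO); exact: Hrepr_L2.
Qed.

Lemma Hdist_ge0 u v : 0 <= Hdist u v. Proof. exact: sqrtr_ge0. Qed.

(** [Hspace] carries a topology given by its open sets, not a metric structure; this supplies the
    epsilon-delta criterion. *)
Lemma Hcontinuous (T : pseudoMetricType R) (g : Hspace Omega -> T) :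
  (forall u (e : R), 0 < e -> exists2 d : R, 0 < d &
    forall v, Hdist u v < d -> ball (g u) e (g v)) -> continuous g.
Proof.
move=> cg; apply/continuousP => A oA.
suff H : Hopen (g @^-1` A) by exact: H.
move=> u Agu.
have : nbhs (g u) A by exact: open_nbhs_nbhs.
rewrite -nbhs_ballE => -[e /= e0 eA].
have [d d0 dg] := cg u e e0; exists d => // v uv.
by apply: eA; exact: dg.
Qed.

(** The Lipschitz constant may depend on the centre [u], and the estimate is asked in its unit ball
    only: the convective term is quadratic in [u]. *)
Lemma continuous_le_Hdist (g : Hspace Omega -> R) :
  (forall u, exists2 C : R, 0 <= C & forall v, Hdist u v <= 1 ->
    `|g u - g v| <= C * Hdist u v) -> continuous g.
Proof.
move=> lg; apply: Hcontinuous => u e e0; have [C C0 gC] := lg u.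
have C1 : 0 < C + 1 by rewrite ltr_wpDl.
exists (Num.min 1 (e / (C + 1))); first by rewrite lt_min ltr01 divr_gt0.
move=> v; rewrite lt_min => /andP[v1 v2]; rewrite /ball/=.
rewrite (le_lt_trans (gC v (ltW v1)))//.
rewrite (@le_lt_trans _ _ ((C + 1) * Hdist u v))//.
  by rewrite ler_wpM2r ?Hdist_ge0// lerDl.
by rewrite mulrC -ltr_pdivlMr.
Qed.

Lemma ip_subl (a b w : vfield R) : L2field Omega a -> L2field Omega b ->
  L2field Omega w -> ip Omega (a - b) w = ip Omega a w - ip Omega b w.
Proof.
move=> La Lb Lw.
rewrite addrC -scaleN1r (ip_linl oO (-1) Lb La Lw); ring.
Qed.

Lemma ip_cont (w : vfield R) : L2field Omega w ->
  continuous (fun u => ip Omega (Hrepr u) w).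
Proof.
move=> Lw; apply: continuous_le_Hdist => u.
exists (3 * nrm Omega w); first by rewrite mulr_ge0// sqrtr_ge0.
move=> v _; rewrite -ip_subl//; [|exact: Hrepr_L2..].
rewrite (le_trans (ip_bound oO (@Hrepr_sub_L2 u v) Lw))//.
by rewrite /Hdist mulrA mulrAC.
Qed.

Lemma F_W_cont p : Wspace Omega p ->
  continuous (fun u => F_W Omega nu f (Hrepr u) p).
Proof.
move=> Wp.
have Lp : L2field Omega p.2 by case: Wp => _ _ [/Hfield_L2].
have Bc := W_Linfty oO fO Wp; set c := fun i j => wpartial Omega j (p.1 i).
have Tc : continuous (fun u : Hspace Omega => trilin Omega c (Hrepr u) (Hrepr u)).
  have [C C0 HC] := trilin_bound oO Bc.
  apply: continuous_le_Hdist => u.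
  (* With d = u - v and T the form, T(u,u) - T(v,v) = T(u,d) + T(d,u) - T(d,d). The first two terms
     account for 2 |u|, the last for 1 because |d| <= 1. *)
  exists (C * (2 * nrm Omega (Hrepr u) + 1)).
    by rewrite mulr_ge0// addr_ge0// mulr_ge0// sqrtr_ge0.
  move=> v uv1.
  have Lu := Hrepr_L2 u; have Lv := Hrepr_L2 v; have Ld := Hrepr_sub_L2 u v.
  have -> : trilin Omega c (Hrepr u) (Hrepr u) - trilin Omega c (Hrepr v) (Hrepr v) =
      trilin Omega c (Hrepr u) (Hrepr u - Hrepr v) +
      trilin Omega c (Hrepr u - Hrepr v) (Hrepr u) -
      trilin Omega c (Hrepr u - Hrepr v) (Hrepr u - Hrepr v).
    have Er (s : vfield R) : L2field Omega s -> trilin Omega c s (Hrepr u - Hrepr v) =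
        trilin Omega c s (Hrepr u) - trilin Omega c s (Hrepr v).
      move=> Ls; rewrite addrC -scaleN1r (trilin_linr oO (-1) Bc Ls Lv Lu); ring.
    have El (s : vfield R) : L2field Omega s -> trilin Omega c (Hrepr u - Hrepr v) s =
        trilin Omega c (Hrepr u) s - trilin Omega c (Hrepr v) s.
      move=> Ls; rewrite addrC -scaleN1r (trilin_linl oO (-1) Bc Lv Lu Ls); ring.
    rewrite (Er _ Lu) (Er _ Ld) (El _ Lu) (El _ Lv); ring.
  have h1 := HC _ _ Lu Ld; have h2 := HC _ _ Ld Lu; have h3 := HC _ _ Ld Ld.
  rewrite (le_trans (ler_normB _ _))//.
  rewrite (le_trans (lerD (le_trans (ler_normD _ _) (lerD h1 h2)) h3))//.
  rewrite -[nrm _ (_ - _)]/(Hdist u v).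
  have := Hdist_ge0 u v; have : 0 <= nrm Omega (Hrepr u) by exact: sqrtr_ge0.
  set n := nrm _ _; set d := Hdist _ _ in uv1 *; move=> n0 d0.
  have dd : C * (d * d) <= C * d by rewrite ler_wpM2l// ler_piMr.
  nra.
apply: (@continuous_add R (Hspace Omega)
  (fun u => f p.1 - nu * ip Omega (Hrepr u) p.2)
  (fun u => trilin Omega c (Hrepr u) (Hrepr u))); last exact: Tc.
apply: (@continuous_add R (Hspace Omega) (fun=> f p.1)); first exact: cst_continuous.
rewrite (_ : (fun u => _) = fun u => - nu * ip Omega (Hrepr u) p.2); last first.
  by apply/funext => u; rewrite mulNr.
apply: (@continuous_mul R (Hspace Omega) (fun=> - nu)); first exact: cst_continuous.
exact: ip_cont.
Qed.

Lemma F_W_bounded p (K : R) : Wspace Omega p ->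
  exists M : R, forall u, Hnorm u <= K -> `|F_W Omega nu f (Hrepr u) p| <= M.
Proof.
move=> Wp.
have Lp : L2field Omega p.2 by case: Wp => _ _ [/Hfield_L2].
have Bc := W_Linfty oO fO Wp; have [C C0 HC] := trilin_bound oO Bc.
exists (`|f p.1| + `|nu| * (3 * (K * nrm Omega p.2)) + C * (K * K)).
move=> u uK; have Lu := Hrepr_L2 u.
have n0 : 0 <= nrm Omega (Hrepr u) by exact: sqrtr_ge0.
rewrite (le_trans (ler_normD _ _))// lerD//.
  rewrite (le_trans (ler_normB _ _))// lerD// normrM ler_wpM2l//.
  rewrite (le_trans (ip_bound oO Lu Lp))// ler_wpM2l// ler_wpM2r// sqrtr_ge0//.
rewrite (le_trans (HC _ _ Lu Lu))// ler_wpM2l// ler_pM//.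
Qed.

End PhaseSpaceFunctionals.

Lemma fst_sum_scale (R : pzRingType) (X Y : lmodType R) (n : nat) (c : 'I_n -> R)
    (p : 'I_n -> X * Y) :
  (\sum_j c j *: p j).1 = \sum_j c j *: (p j).1.
Proof. by rewrite (big_morph fst (id1 := 0) (op1 := +%R)). Qed.

(** * Continuity and bounds of <F(u), Psi'(u)> *)

Section Cylinder.
Context {R : realType} (Omega : set (R3 R)).
Hypotheses (oO : open Omega) (fO : (leb3 Omega < +oo)%E).
Variables (nu : R) (f : vfield R -> R) (f_dual : V_dual Omega f).
Variable Psi : cylindrical (Wspace Omega).
Implicit Types (u v : Hspace Omega).

Local Notation w := (@cyl_vec _ _ _ Psi).
Local Notation psi := (@cyl_fun _ _ _ Psi).
Local Notation coord u := (cyl_coord Psi (H_to_Wdual Omega (Hrepr u))).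

Lemma coord_cont : continuous (fun u : Hspace Omega => coord u).
Proof.
have L j : L2field Omega (w j).1.
  by apply/Hfield_L2/Vfield_Hfield/Wspace_V; exact: cyl_vecP.
apply: Hcontinuous => u e e0.
(* [C] dominates every coordinate's constant at once; the 1 keeps it positive, even when there are
   no coordinates. *)
pose nw j := 3 * nrm Omega (w j).1; pose C := \sum_j nw j + 1.
have nw0 j : 0 <= nw j by rewrite mulr_ge0// sqrtr_ge0.
have C0 : 0 < C by rewrite ltr_wpDl// sumr_ge0.
exists (e / C) => [|v uv]; first by rewrite divr_gt0.
split=> // i j; rewrite !mxE /ball/= /H_to_Wdual.
rewrite -(ip_subl oO (Hrepr_L2 u) (Hrepr_L2 v) (L j)).
rewrite (le_lt_trans (ip_bound oO (Hrepr_sub_L2 oO u v) (L j)))//.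
rewrite ltr_pdivlMr// in uv; apply: le_lt_trans uv.
rewrite mulrCA ler_wpM2l ?sqrtr_ge0// /C (bigD1 j)//= -addrA lerDl addr_ge0//.
by apply: sumr_ge0.
Qed.

(** Off the closed support [psi] is locally zero and so is its derivative; on that compact set the
    derivative is continuous. *)
Lemma derive_bounded (d : 'rV[R]_(cyl_dim Psi)) :
  exists M : R, forall x, `|'D_d psi x| <= M.
Proof.
have [dpsi cpsi] := cyl_C1 Psi; have supp := @cyl_supp _ _ _ Psi.
have /compact_bounded[M [_ HM]] : compact ('D_d psi @` closure [set x | psi x != 0]).
  by apply: continuous_compact => //; apply: continuous_subspaceT; exact: cpsi.
exists (`|M| + 1) => x.
have M1 : M < `|M| + 1 by rewrite (le_lt_trans (ler_norm M))// ltrDl.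
have [xc|nx] := pselect (closure [set x | psi x != 0] x).
  by apply: (HM _ M1); exists x.
have nbx : nbhs x (~` closure [set x | psi x != 0]).
  by apply: open_nbhs_nbhs; split => //; apply: closed_openC; exact: closed_closure.
rewrite (@near_eq_derive _ _ _ psi (cst 0)) ?derive_cst ?normr0 ?addr_ge0//.
apply: filterS nbx => y ny; apply/eqP/negP => /negP y0; apply: ny.
exact: subset_closure.
Qed.

Lemma F_cyl_WE u : F_cyl_W nu f Psi u =
  \sum_j 'D_(delta_mx 0 j) psi (coord u) * F_W Omega nu f (Hrepr u) (w j).
Proof.
rewrite /F_cyl_W /cyl_deriv.
exact: (F_W_sum oO fO nu f_dual _ (Hrepr_L2 u) (@cyl_vecP _ _ _ Psi)).
Qed.

(** Continuity is wanted for measurability with respect to the Borel sets of H. *)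
Lemma F_cyl_W_cont : continuous (F_cyl_W nu f Psi : Hspace Omega -> R).
Proof.
have [_ cpsi] := cyl_C1 Psi.
rewrite (_ : F_cyl_W _ _ _ = fun u => \sum_j 'D_(delta_mx 0 j) psi (coord u) *
   F_W Omega nu f (Hrepr u) (w j)); last by apply/funext => u; rewrite F_cyl_WE.
apply: (@continuous_sum R (Hspace Omega) _ (fun j u =>
  'D_(delta_mx 0 j) psi (coord u) * F_W Omega nu f (Hrepr u) (w j))) => j.
apply: (@continuous_mul R (Hspace Omega)
    (fun u => 'D_(delta_mx 0 j) psi (coord u))); last first.
  exact: (@F_W_cont _ _ oO fO nu f _ (@cyl_vecP _ _ _ Psi j)).
move=> u; apply: (@continuous_comp _ _ _ (fun u => coord u) ('D_(delta_mx 0 j) psi)).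
  exact: coord_cont.
exact: cpsi.
Qed.

Lemma F_cyl_W_bounded (E : set (Hspace Omega)) : Hbounded E ->
  exists M : R, forall u, E u -> `|F_cyl_W nu f Psi u| <= M.
Proof.
move=> [K EK].
have /choice[A HA] : forall j, exists M : R,
  forall x, `|'D_(delta_mx 0 j) psi x| <= M by move=> j; exact: derive_bounded.
have /choice[B HB] : forall j, exists M : R,
    forall u, Hnorm u <= K -> `|F_W Omega nu f (Hrepr u) (w j)| <= M.
  by move=> j; exact: (@F_W_bounded _ _ oO fO nu f _ K (@cyl_vecP _ _ _ Psi j)).
exists (\sum_j A j * B j) => u Eu; rewrite F_cyl_WE.
rewrite (le_trans (ler_norm_sum _ _ _))//; apply: ler_sum => j _.
by rewrite normrM ler_pM// HB// EK.
Qed.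

(** [Psi] seen as a test function for the Foias-Prodi condition: each pair (w, A w) is reduced to w,
    which lies in V. *)
Definition cyl_V : cylindrical (Vfield Omega) :=
  @Cylindrical R (vfield R) (Vfield Omega) (cyl_dim Psi) (fun j => (w j).1) psi
    (fun j => Wspace_V (@cyl_vecP _ _ _ Psi j)) (cyl_C1 Psi) (@cyl_supp _ _ _ Psi).

Lemma F_cyl_W_V u : V u -> F_cyl_W nu f Psi u = F_cyl_V nu f cyl_V u.
Proof.
move=> Vu; have WD : Wspace Omega (cyl_deriv Psi (H_to_Wdual Omega (Hrepr u))).
  exact: (Wspace_sum oO fO _ (@cyl_vecP _ _ _ Psi)).
(* Both embeddings of H pair [u] with w through the same L^2 product, so the coordinates coincide by
   definition and only the first projection of the derivative is left. *)
rewrite /F_cyl_W (F_W_eq_F_V oO fO nu f Vu WD) /F_cyl_V; congr (F_V _ _ _ _ _).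
exact: fst_sum_scale.
Qed.

End Cylinder.

(** * Stationary statistical solutions *)

Section IntegralOffNegligible.
Context d (T : measurableType d) (R : realType) (mu : {measure set T -> \bar R}).
Local Open Scope ereal_scope.

Import HBNNSimple.

Lemma ge0_le_integral_nonmeasurable (f g : T -> \bar R) :
  (forall x, 0 <= f x) -> (forall x, f x <= g x) ->
  \int[mu]_x f x <= \int[mu]_x g x.
Proof.
move=> f0 fg; have g0 x : 0 <= g x by exact: le_trans (fg x).
rewrite !ge0_integralTE//; apply: ereal_sup_le => _ [h hf <-].
by exists h => // x; exact: le_trans (fg x).
Qed.

(* D need not be measurable, hence the detour through the definition of the
   integral as a supremum over simple functions. *)
Lemma ge0_integral_conegligible (D : set T) (f : T -> \bar R) :
  mu.-negligible (~` D) -> measurable_fun setT f -> (forall x, 0 <= f x) ->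
  \int[mu]_(x in D) f x = \int[mu]_x f x.
Proof.
move=> [N [mN N0 DN]] mf f0; apply/eqP; rewrite eq_le; apply/andP; split.
  rewrite integral_mkcond; apply: ge0_le_integral_nonmeasurable => x.
    by apply: erestrict_ge0.
  by rewrite patchE; case: ifP.
rewrite (ge0_negligible_integral mN measurableT mf (fun x _ => f0 x) N0).
rewrite integral_mkcond [leRHS]integral_mkcond.
apply: ge0_le_integral_nonmeasurable => x; first exact: erestrict_ge0.
rewrite !patchE; case: ifPn => [/set_mem[_ Nx]|_]; last by case: ifP.
by rewrite mem_set//; apply: contrapT => Dx; apply: Nx; exact: DN.
Qed.

(** Used with [D = V], to turn the Foias-Prodi identity over V into the weak identity over H. *)
Lemma integral_conegligible (D : set T) (f : T -> \bar R) :
  mu.-negligible (~` D) -> measurable_fun setT f ->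
  \int[mu]_(x in D) f x = \int[mu]_x f x.
Proof.
move=> nD mf; rewrite integralE [RHS]integralE.
rewrite !ge0_integral_conegligible//.
- exact: measurable_funeneg.
- exact: measurable_funepos.
Qed.

End IntegralOffNegligible.

Section LeIntegral.
Context d (T : measurableType d) (R : realType) (mu : {measure set T -> \bar R}).
Local Open Scope ereal_scope.

(** Positive parts increase and negative parts decrease, and subtraction of extended reals is
    monotone with +oo - +oo = -oo. This covers a [phi] whose integral is infinite or of the form +oo
    - +oo. *)
Lemma le_integral_nonintegrable (D : set T) (f g : T -> \bar R) :
  measurable D -> measurable_fun D f -> measurable_fun D g ->
  (forall x, D x -> f x <= g x) ->
  \int[mu]_(x in D) f x <= \int[mu]_(x in D) g x.
Proof.
move=> mD mf mg fg; rewrite integralE [leRHS]integralE; apply: leeB.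
- apply: ge0_le_integral => //; [exact: measurable_funepos..|].
  by move=> x Dx; rewrite !funeposE ge_max !le_max fg//= lexx orbT.
- apply: ge0_le_integral => //; [exact: measurable_funeneg..|].
  by move=> x Dx; rewrite !funenegE ge_max !le_max leeN2 fg//= lexx orbT.
Qed.

End LeIntegral.

Section HspaceMeasurability.
Context {R : realType} (Omega : set (R3 R)).

Lemma Hopen_measurable (U : set (Hspace Omega)) : open U ->
  measurable (U : set (Hborel Omega)).
Proof. by move=> oU; exact: sub_sigma_algebra. Qed.

Lemma continuous_measurable_H (g : Hspace Omega -> R) : continuous g ->
  measurable_fun setT (g : Hborel Omega -> R).
Proof.
move=> cg; apply: (measurability _ (RGenOpens.measurableE R)).
move=> _ [_ [a [b ->] <-]]; rewrite setTI; apply: Hopen_measurable.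
exact: (@open_comp _ _ g `]a, b[%classic (fun x _ => cg x)).
Qed.

(** Continuity for the subspace topology makes each preimage of an open interval the trace on [E] of
    an open set of H. *)
Lemma within_continuous_measurable_H (E : set (Hspace Omega))
    (g : Hspace Omega -> R) : measurable (E : set (Hborel Omega)) ->
  {within E, continuous g} ->
  measurable_fun (E : set (Hborel Omega)) (g : Hborel Omega -> R).
Proof.
move=> mE /continuousP cg; apply: (measurability _ (RGenOpens.measurableE R)).
move=> _ [_ [a [b ->] <-]].
have oab : open (`]a, b[%classic : set R) by exact: interval_open.
have /open_subspaceP[U oU UE] := cg _ oab.
rewrite setIC -UE; apply: measurableI => //; exact: Hopen_measurable.
Qed.

End HspaceMeasurability.

(** * Inclusion of the two classes of solutions and the upper bound *)

Section Comparison.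
Context {R : realType} (Omega : set (R3 R)).
Hypotheses (oO : open Omega) (fO : (leb3 Omega < +oo)%E).
Variables (nu : R) (f : vfield R -> R) (f_dual : V_dual Omega f).
Variable E : set (Hspace Omega).
Hypothesis mE : measurable (E : set (Hborel Omega)).

Lemma F_cyl_W_measurable (Psi : cylindrical (Wspace Omega)) :
  measurable_fun setT (F_cyl_W nu f Psi : Hborel Omega -> R).
Proof.
apply: continuous_measurable_H.
exact: (F_cyl_W_cont oO fO (nu:=nu) f_dual (Psi:=Psi)).
Qed.

Lemma P_fpsss_wsss : Hbounded E -> P_fpsss nu f E `<=` P_wsss nu f E.
Proof.
move=> bE mu [[[_ nV] _ F0] cE]; split; last exact: cE.
move=> Psi; have mF := F_cyl_W_measurable Psi.
split; last first.
  have mF' : measurable_fun setT (EFin \o F_cyl_W nu f Psi : Hborel Omega -> \bar R).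
    exact/measurable_EFinP.
  rewrite -[RHS](F0 (cyl_V Psi)) -(integral_conegligible nV mF').
  by apply: eq_integral => u /set_mem Vu; rewrite /= (F_cyl_W_V oO fO nu f Psi Vu).
have [M HM] := F_cyl_W_bounded oO fO nu f_dual Psi bE.
apply/integrableP; split; first exact/measurable_EFinP.
(* The bound holds on [E], hence almost everywhere for a measure carried by [E], and constants are
   integrable for a probability. *)
apply: (@le_lt_trans _ _ (\int[mu]_u (cst `|M|%:E u))%E).
  apply: ae_ge0_le_integral => //.
    by apply: measurableT_comp => //; exact/measurable_EFinP.
  by move=> u _; rewrite lee_fin.
  exists (~` E); split; [exact: measurableC|exact: cE|].
  move=> u /= h Eu; apply: h => _; rewrite lee_fin (le_trans (HM u Eu))//.
  exact: ler_norm.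
rewrite integral_cst//.
by rewrite [X in (_ * X < _)%E](@probability_setT _ _ _ mu) mule1 ltry.
Qed.

Lemma wsss_le_sup (mu : probability (Hborel Omega) R) (phi : Hspace Omega -> R)
    (Psi : cylindrical (Wspace Omega)) :
  P_wsss nu f E mu -> {within E, continuous phi} ->
  (\int[mu]_(u in (E : set (Hborel Omega))) (phi u)%:E <=
   ereal_sup [set (phi u + F_cyl_W nu f Psi u)%:E | u in E])%E.
Proof.
move=> [wmu cE] cphi; have [iF F0] := wmu Psi.
have mphi := within_continuous_measurable_H mE cphi.
have muE : mu E = 1%E.
  by rewrite -[X in mu X]setCK probability_setC ?cE ?sube0//; exact: measurableC.
(* The weak identity is an integral over H; removing the null complement of [E] keeps it zero. *)
have FE : (\int[mu]_(u in (E : set (Hborel Omega))) (F_cyl_W nu f Psi u)%:E = 0)%E.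
  rewrite -F0 [RHS](@negligible_integral _ _ _ mu setT (~` E))//.
  - by rewrite setTD setCK.
  - exact: measurableC.
set S := ereal_sup _.
have Sub u : E u -> ((phi u + F_cyl_W nu f Psi u)%:E <= S)%E.
  by move=> Eu; apply: ereal_sup_ubound; exists u.
have [u0 Eu0] : E !=set0.
  apply/set0P/negP => /eqP E0; move: muE; rewrite E0 measure0 => /eqP.
  by rewrite eq_sym onee_eq0.
(* The value +oo is trivial and -oo is excluded by a point of [E]. For a finite s, integrate phi <=
   s - <F, Psi'> over [E], which has mass 1. *)
case ES : S (Sub) => [s| |] Sub'; last 2 first.
- exact: leey.
- by have := Sub' _ Eu0.
have iFE : mu.-integrable E (EFin \o F_cyl_W nu f Psi).
  exact: integrableS iF.
have icst : mu.-integrable E (cst s%:E).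
  exact: finite_measure_integrable_cst.
have <- : (\int[mu]_(u in (E : set (Hborel Omega)))
    (cst s%:E \- (EFin \o F_cyl_W nu f Psi)) u)%E = s%:E.
  by rewrite integralB// integral_cst//= [X in (_ * X)%E]muE FE mule1 sube0.
apply: le_integral_nonintegrable => //.
- exact/measurable_EFinP.
- exact: measurable_int (integrableB mE icst iFE).
- by move=> u Eu /=; rewrite -EFinB lee_fin lerBrDr -lee_fin; exact: Sub'.
Qed.

End Comparison.

Theorem theorem6p3 (R : realType) (Omega : set (R3 R))
    (Omega_domain : smooth_bounded_domain Omega)
    (nu : R) (nu_gt0 : 0 < nu)
    (f : vfield R -> R) (f_dual : V_dual Omega f)
    (E : set (Hspace Omega))
    (E_borel : measurable (E : set (Hborel Omega)))
    (E_bounded : Hbounded E)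
    (E_wsss : P_wsss nu f E !=set0)
    (phi : Hspace Omega -> R) (phi_cont : {within E, continuous phi}) :
  (ereal_sup [set \int[mu]_(u in (E : set (Hborel Omega))) (phi u)%:E
               | mu in P_fpsss nu f E]
   <= ereal_sup [set \int[mu]_(u in (E : set (Hborel Omega))) (phi u)%:E
                  | mu in P_wsss nu f E])%E /\
  (ereal_sup [set \int[mu]_(u in (E : set (Hborel Omega))) (phi u)%:E
               | mu in P_wsss nu f E]
   <= ereal_inf
        [set ereal_sup [set (phi u + F_cyl_W nu f Psi u)%:E | u in E]
          | Psi in [set: cylindrical (Wspace Omega)]])%E.
Proof.
have oO : open Omega by case: Omega_domain.
have fO := domain_finite Omega_domain.
split.
  apply: ereal_sup_le => _ [mu Pmu <-]; exists mu => //.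
  exact: (P_fpsss_wsss oO fO f_dual E_borel E_bounded Pmu).
apply: le_ereal_inf_tmp => _ [Psi _ <-]; apply: ge_ereal_sup => _ [mu Pmu <-].
exact: (wsss_le_sup E_borel Psi Pmu phi_cont).
Qed.
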